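(* Let $\mathcal{R}$ be an ergodic countable measured (non-singular) equivalence relation on a standard probability space $(X,\mu)$. Then the following are equivalent: (1) The probability measure $\mu$ is diffuse (equivalently, $\mathcal{R}$ is not of type I). (2) There exists a genuine discrete measured groupoid $\mathcal{G}$ with unit space $(X,\mu)$ and associated equivalence relation $\mathcal{R}$. (3) There exists a genuine icc discrete measured groupoid $\mathcal{G}$ with unit space $(X,\mu)$ and associated equivalence relation $\mathcal{R}$.
   Context: Discrete measured groupoids. A discrete Borel groupoid $\mathcal{G}$ is a groupoid with a standard Borel structure such that the unit space $\mathcal{G}^{(0)}$ is a Borel subset, the operations are Borel, and the source and target maps $s,t:\mathcal{G}\to\mathcal{G}^{(0)}$ are countable-to-one Borel maps. If $X=\mathcal{G}^{(0)}$ carries a Borel probability measure $\mu$, put $\mu_s(A)=\int_X \#(A\cap s^{-1}(x))\,d\mu(x)$ and $\mu_t(A)=\int_X \#(A\cap t^{-1}(x))\,d\mu(x)$ for Borel $A\subseteq\mathcal{G}$. $\mathcal{G}$ is a discrete measured groupoid with unit space $(X,\mu)$ if $\mu_s$ and $\mu_t$ have the same null sets. Two discrete measured groupoids are isomorphic if there is a nonsingular Borel isomorphism between them preserving multiplication and inverses. As usual in the measured setting, isomorphisms and identifications are understood up to null sets, i.e. after restricting to conull Borel subsets of the unit spaces. Equivalence relations. A countable measured equivalence relation $\mathcal{R}$ on a standard probability space $(X,\mu)$ is an equivalence relation that is a Borel subset of $X\times X$, has countable classes, and is non-singular: for every non-null Borel $E\subseteq X$, the saturation $\mathcal{R}(E)=\{y\in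 X : (y,x)\in\mathcal{R}\text{ for some }x\in E\}$ is non-null (equivalently, $\mu_s$ and $\mu_t$ are equivalent on $\mathcal{R}$). It is a discrete measured groupoid with unit space $(X,\mu)$, where $(x,y)$ has source $y$ and target $x$. $\mathcal{R}$ is ergodic if every $\mathcal{R}$-invariant Borel subset of $X$ is $\mu$-null or $\mu$-conull. An ergodic $\mathcal{R}$ is of type I$_n$, $n\in\{1,2,\dots,\infty\}$, if it is isomorphic to the complete equivalence relation on a set of $n$ elements ($n=\infty$ meaning countably infinite), and of type I if it is of type I$_n$ for some $n$. The equivalence relation associated to a discrete measured groupoid $\mathcal{G}$ is $\mathcal{R}_{\mathcal{G}}=\{(t(g),s(g)) : g\in\mathcal{G}\}$, and $\mathcal{G}$ is ergodic if $\mathcal{R}_{\mathcal{G}}$ is. Transformation groupoids. For a nonsingular action $G\curvearrowright(X,\mu)$ of a countable discrete group on a standard probability space, the transformation groupoid is $X\rtimes G=\{(x,g): x\in X, g\in G\}$ with unit space $(X,\mu)$, $s(x,g)=x$, $t(x,g)=gx$, $(gx,h)(x,g)=(x,hg)$, $(x,g)^{-1}=(gx,g^{-1})$. Genuine. An ergodic discrete measured groupoid is called genuine if it is not isomorphic to a countable measured equivalence relation nor to a transformation groupoid. Icc. Let $\mathrm{Iso}(\mathcal{G})=\{g\in\mathcal{G}: s(g)=t(g)\}$. For $E\subseteq\mathrm{Iso}(\mathcal{G})$ Borel, its conjugacy class is $\Omega_E=\bigcup_{g\in\mathcal{G}} gEg^{-1}=\{ghg^{-1}: h\in E,\ g\in\mathcal{G},\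 s(g)=t(h)\}$. $\mathcal{G}$ is icc (infinite conjugacy class) if for every non-null Borel subset $E\subseteq\mathrm{Iso}(\mathcal{G})$ such that $\Omega_E$ has finite measure ($\mu_s(\Omega_E)<\infty$), one has $E\subseteq\mathcal{G}^{(0)}$ up to a null set. *)

(* Defs.v *)
From HB Require Import structures.
From mathcomp Require Import all_boot all_order all_algebra.
From mathcomp Require Import all_classical all_reals all_analysis.

Set Implicit Arguments.
Unset Strict Implicit.
Unset Printing Implicit Defensive.

Import Order.TTheory GRing.Theory Num.Theory.

Local Open Scope classical_set_scope.
Local Open Scope ereal_scope.

(** Mackey's definition: isomorphic, as a measurable space, to a Borel subset
    of a complete separable metric space.  The last clause with [A := setT]
    says that the range of [f] is Borel. *)
Definition standard_borel (R : realType) d (T : measurableType d) : Prop :=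
  exists (M : metricType R) (f : T -> M),
    [/\ forall F : set_system M, ProperFilter F -> cauchy F ->
          exists l : M, F --> l,
        exists2 D : set M, countable D & dense D,
        injective f
      & forall A : set T, measurable A <-> <<s @open M >> (f @` A)].

(** A groupoid with objects [X] and arrows [G]; objects are embedded among the
    arrows by [gunit].  [gmul a b] is the product [ab], meaningful only when
    [gsrc a = gtgt b]; the values of [gmul] on other pairs are irrelevant. *)
Record groupoid (X G : Type) := Groupoid {
  gsrc : G -> X;
  gtgt : G -> X;
  gunit : X -> G;
  ginv : G -> G;
  gmul : G -> G -> G;
  src_gunit : forall x, gsrc (gunit x) = x;
  tgt_gunit : forall x, gtgt (gunit x) = x;
  src_ginv : forall a, gsrc (ginv a) = gtgt a;
  tgt_ginv : forall a, gtgt (ginv a) = gsrc a;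
  src_mul : forall a b, gsrc a = gtgt b -> gsrc (gmul a b) = gsrc b;
  tgt_mul : forall a b, gsrc a = gtgt b -> gtgt (gmul a b) = gtgt a;
  mul_assoc : forall a b c, gsrc a = gtgt b -> gsrc b = gtgt c ->
    gmul a (gmul b c) = gmul (gmul a b) c;
  mul_unt_l : forall a, gmul (gunit (gtgt a)) a = a;
  mul_unt_r : forall a, gmul a (gunit (gsrc a)) = a;
  mul_inv_l : forall a, gmul (ginv a) a = gunit (gsrc a);
  mul_inv_r : forall a, gmul a (ginv a) = gunit (gtgt a)
}.

Section groupoid_sets.
Context (X G : Type) (g : groupoid X G).

Definition units : set G := range (gunit g).

Definition orbit_rel : set (X * X) := range (fun a => (gtgt g a, gsrc g a)).

Definition isotropy : set G := [set a | gsrc g a = gtgt g a].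

Definition conj_class (E : set G) : set G :=
  [set c | exists a b, [/\ E b, gsrc g a = gtgt g b
                         & c = gmul g (gmul g a b) (ginv g a)]].

Definition reduction (X0 : set X) : set G :=
  [set a | X0 (gsrc g a) /\ X0 (gtgt g a)].

End groupoid_sets.

Section measured_groupoid.
Context (R : realType) d (X : measurableType d) (mu : probability X R).
Context d' (G : measurableType d').
Implicit Types (g : groupoid X G) (A : set G).

Definition discrete_borel_groupoid g : Prop :=
  [/\ standard_borel R G, measurable (units g),
      [/\ measurable_fun setT (gsrc g), measurable_fun setT (gtgt g),
          measurable_fun setT (gunit g), measurable_fun setT (ginv g)
        & measurable_fun [set p : G * G | gsrc g p.1 = gtgt g p.2]
            (fun p => gmul g p.1 p.2)]
    & forall x, countable (gsrc g @^-1` [set x]) /\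
                countable (gtgt g @^-1` [set x])].

Definition mu_src g A : \bar R :=
  \int[mu]_x counting (A `&` gsrc g @^-1` [set x]).

Definition mu_tgt g A : \bar R :=
  \int[mu]_x counting (A `&` gtgt g @^-1` [set x]).

Definition nonsingular g : Prop :=
  forall A, measurable A -> mu_src g A = 0 <-> mu_tgt g A = 0.

Definition discrete_measured_groupoid g : Prop :=
  discrete_borel_groupoid g /\ nonsingular g.

Definition icc g : Prop :=
  forall E : set G, measurable E -> E `<=` isotropy g -> mu_src g E != 0 ->
    mu_src g (conj_class g E) < +oo -> mu_src g (E `\` units g) = 0.

End measured_groupoid.

Definition conull (R : realType) d (X : measurableType d)
    (mu : probability X R) (X0 : set X) : Prop :=
  measurable X0 /\ mu (~` X0) = 0.

(** Isomorphism up to null sets: after restricting to conull Borel sets [X0]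
    and [Y0] of units, [phi] is a nonsingular Borel isomorphism, with inverse
    [psi].  Both are total functions, only used on the reductions. *)
Definition isomorphic (R : realType)
    d (X : measurableType d) (mu : probability X R)
    d1 (G : measurableType d1) (g : groupoid X G)
    d' (Y : measurableType d') (nu : probability Y R)
    d2 (H : measurableType d2) (h : groupoid Y H) : Prop :=
  exists (X0 : set X) (Y0 : set Y) (phi : G -> H) (psi : H -> G),
    let GX := reduction g X0 in
    let HY := reduction h Y0 in
    [/\ conull mu X0 /\ conull nu Y0,
        [/\ phi @` GX `<=` HY, psi @` HY `<=` GX,
            forall a, GX a -> psi (phi a) = a
          & forall b, HY b -> phi (psi b) = b],
        measurable_fun GX phi /\ measurable_fun HY psi,
        [/\ forall a b, GX a -> GX b ->
              gsrc g a = gtgt g b <-> gsrc h (phi a) = gtgt h (phi b),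
            forall a b, GX a -> GX b -> gsrc g a = gtgt g b ->
              phi (gmul g a b) = gmul h (phi a) (phi b)
          & forall a, GX a -> phi (ginv g a) = ginv h (phi a)]
      & forall A, measurable A -> A `<=` GX ->
          mu_src mu g A = 0 <-> mu_src nu h (phi @` A) = 0].

Record eqv_rel (X : Type) := EqvRel {
  rel_of : set (X * X);
  eqv_rel_refl : forall x, rel_of (x, x);
  eqv_rel_sym : forall x y, rel_of (x, y) -> rel_of (y, x);
  eqv_rel_trans : forall x y z, rel_of (x, y) -> rel_of (y, z) -> rel_of (x, z)
}.

Definition full_eqv_rel (X : Type) : eqv_rel X :=
  @EqvRel X setT (fun _ => I) (fun _ _ _ => I) (fun _ _ _ _ _ => I).

(** The relation itself as a measurable space, with the σ-algebra induced from
    the product. *)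
Section eqv_rel_space.
Context d (X : measurableType d) (S : eqv_rel X).

Definition eqv_rel_points : Type := set_type (rel_of S).

HB.instance Definition _ := Choice.on eqv_rel_points.
HB.instance Definition _ := isPointed.Build eqv_rel_points
  (exist _ (point, point) (mem_set (eqv_rel_refl S point))).

Definition eqv_rel_space :=
  g_sigma_algebra_preimageType (fun p : eqv_rel_points => \val p : X * X).

HB.instance Definition _ := Measurable.on eqv_rel_space.

End eqv_rel_space.

Section eqv_rel_groupoid.
Context d (X : measurableType d) (S : eqv_rel X).

Let src_ (p : eqv_rel_space S) : X := (\val p).2.
Let tgt_ (p : eqv_rel_space S) : X := (\val p).1.

Let mk x y (xy : rel_of S (x, y)) : eqv_rel_space S := exist _ (x, y) (mem_set xy).

Let eqv_rel_mem (p : eqv_rel_space S) : rel_of S (tgt_ p, src_ p).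
Proof. by rewrite /tgt_ /src_ -surjective_pairing; exact: set_mem (valP p). Qed.

Let eqv_rel_mul_mem p q : src_ p = tgt_ q -> rel_of S (tgt_ p, src_ q).
Proof.
move=> pq; apply: (eqv_rel_trans (eqv_rel_mem p)).
by rewrite pq; exact: eqv_rel_mem.
Qed.

Let unt_ x := mk (eqv_rel_refl S x).
Let inv_ p := mk (eqv_rel_sym (eqv_rel_mem p)).
Let mul_ p q : eqv_rel_space S :=
  if pselect (src_ p = tgt_ q) is left pq then mk (eqv_rel_mul_mem pq) else p.

Let eqv_rel_eq (p q : eqv_rel_space S) : tgt_ p = tgt_ q -> src_ p = src_ q -> p = q.
Proof.
rewrite /tgt_ /src_ => t12 s12; apply: val_inj.
by case: (\val p) (\val q) t12 s12 => [? ?] [? ?] /= -> ->.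
Qed.

Let tgt_mul_ p q : src_ p = tgt_ q -> tgt_ (mul_ p q) = tgt_ p.
Proof. by rewrite /mul_; case: pselect. Qed.

Let src_mul_ p q : src_ p = tgt_ q -> src_ (mul_ p q) = src_ q.
Proof. by rewrite /mul_; case: pselect. Qed.

Definition eqv_rel_groupoid : groupoid X (eqv_rel_space S).
Proof.
refine (@Groupoid _ _ src_ tgt_ unt_ inv_ mul_
  _ _ _ _ src_mul_ tgt_mul_ _ _ _ _ _) => //.
{ move=> a b c ab bc; apply: eqv_rel_eq.
    by rewrite !tgt_mul_// src_mul_.
  by rewrite !src_mul_ ?tgt_mul_// src_mul_. }
all: by move=> a; apply: eqv_rel_eq; rewrite ?tgt_mul_ ?src_mul_.
Defined.

End eqv_rel_groupoid.

(** Non-singularity is equivalence of [mu_src] and [mu_tgt] on the relation,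
    i.e. saturations of null sets are null. *)
Definition countable_measured_eqv_rel (R : realType) d (X : measurableType d)
    (mu : probability X R) (S : eqv_rel X) : Prop :=
  [/\ measurable (rel_of S),
      forall x, countable [set y | rel_of S (x, y)]
    & nonsingular mu (eqv_rel_groupoid S)].

Definition ergodic (R : realType) d (X : measurableType d)
    (mu : probability X R) (S : set (X * X)) : Prop :=
  forall A : set X, measurable A ->
    (forall x y, S (x, y) -> A x -> A y) -> mu A = 0 \/ mu (~` A) = 0.

(** [n = None] stands for type I_∞. *)
Definition type_I_n (R : realType) d (X : measurableType d)
    (mu : probability X R) (S : eqv_rel X) (n : option nat) : Prop :=
  exists d' (Y : measurableType d') (nu : probability Y R),
    [/\ standard_borel R Y,
        ([set: Y] #= if n is Some k then `I_k else [set: nat])%card,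
        countable_measured_eqv_rel nu (full_eqv_rel Y)
      & isomorphic mu (eqv_rel_groupoid S) nu (eqv_rel_groupoid (full_eqv_rel Y))].

Definition type_I (R : realType) d (X : measurableType d)
    (mu : probability X R) (S : eqv_rel X) : Prop :=
  exists n, type_I_n mu S n.

(** A group with the σ-algebra of all its subsets. *)
Definition discrete_group (Gam : groupType) : Type := Gam.

Section discrete_group.
Context (Gam : groupType).

HB.instance Definition _ := Group.on (discrete_group Gam).
HB.instance Definition _ :=
  isPointed.Build (discrete_group Gam) (1 : discrete_group Gam)%g.
HB.instance Definition _ := @isMeasurable.Build default_measure_display
  (discrete_group Gam) discrete_measurable (@discrete_measurable0 _)
  (@discrete_measurableC _) (@discrete_measurableU _).

End discrete_group.

Record group_action (Gam : groupType) (X : Type) := GroupAction {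
  act :> Gam -> X -> X;
  act1 : forall x, act 1%g x = x;
  actM : forall a b x, act (a * b)%g x = act a (act b x)
}.

Definition nonsingular_action (R : realType) d (X : measurableType d)
    (mu : probability X R) (Gam : groupType) (act : group_action Gam X) : Prop :=
  forall a : Gam, measurable_fun setT (act a) /\
    forall A, measurable A -> mu (act a @^-1` A) = 0 <-> mu A = 0.

Section transformation_groupoid.
Context d (X : measurableType d) (Gam : groupType) (act : group_action Gam X).

Let T := (X * discrete_group Gam)%type.

Let actK a x : act a^-1%g (act a x) = x.
Proof. by rewrite -actM mulVg act1. Qed.

Definition transformation_groupoid : groupoid X T.
Proof.
refine (@Groupoid X T (fun p => p.1) (fun p => act p.2 p.1)
  (fun x => (x, 1%g : Gam)) (fun p => (act p.2 p.1, (p.2 : Gam)^-1%g))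
  (fun p q => (q.1, ((p.2 : Gam) * q.2)%g)) _ _ _ _ _ _ _ _ _ _ _) => //=.
- exact: act1.
- by move=> [x a] [y b] /= ->; rewrite actM.
- by move=> [x a] [y b] [z c] /=; rewrite mulgA.
- by move=> [x a] /=; rewrite mul1g.
- by move=> [x a] /=; rewrite mulg1.
- by move=> [x a] /=; rewrite mulVg.
- by move=> [x a] /=; rewrite mulgV.
Defined.

End transformation_groupoid.

Section genuine.
Context (R : realType) d (X : measurableType d) (mu : probability X R).
Context d' (G : measurableType d') (g : groupoid X G).

Definition isomorphic_to_eqv_rel : Prop :=
  exists dY (Y : measurableType dY) (nu : probability Y R) (S : eqv_rel Y),
    [/\ standard_borel R Y, countable_measured_eqv_rel nu S
      & isomorphic mu g nu (eqv_rel_groupoid S)].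

Definition isomorphic_to_transformation_groupoid : Prop :=
  exists dY (Y : measurableType dY) (nu : probability Y R)
    (Gam : groupType) (act : group_action Gam Y),
    [/\ standard_borel R Y, countable [set: Gam], nonsingular_action nu act
      & isomorphic mu g nu (transformation_groupoid act)].

Definition genuine : Prop :=
  [/\ ergodic mu (orbit_rel g), ~ isomorphic_to_eqv_rel
    & ~ isomorphic_to_transformation_groupoid].

End genuine.

Section associated_relation.
Context (R : realType) d (X : measurableType d) (mu : probability X R).
Context d' (G : measurableType d') (g : groupoid X G) (S : eqv_rel X).

(** The equivalence relation of [g] is [S], up to null sets. *)
Definition associated_eqv_rel : Prop :=
  exists2 X0, conull mu X0 & forall x y, X0 x -> X0 y ->
    orbit_rel g (x, y) <-> rel_of S (x, y).

End associated_relation.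

Definition diffuse (R : realType) d (X : measurableType d)
    (mu : probability X R) : Prop :=
  forall x, mu [set x] = 0.

(* Main.v *)
Require Import Defs.
From HB Require Import structures.
From mathcomp Require Import all_boot all_order all_algebra.
From mathcomp Require Import all_classical all_reals all_analysis.
From mathcomp Require Import measurable_realfun zify lra.

(** Suppose first that the measure has an atom.  By ergodicity its orbit is
    conull, and it is countable, so that the relation is, up to null sets, the
    complete relation on a countable set ([type_I_of_atom]).  Likewise a groupoid
    with this unit space lives on one countable orbit.  Such a groupoid is the
    product of the complete relation on the orbit with the isotropy group; giving
    the orbit the structure of a group that acts on it by translations makes it a
    transformation groupoid, so it is not genuine ([genuine_diffuse]).
    Conversely a complete relation on a countable set has a point of positive
    mass, so that a diffuse measure excludes type I ([diffuse_not_type_I]).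

    Now let the measure be diffuse.  Each point [x] is identified with a sequence
    of bits, and almost every orbit [C] is given the group of permutations of the
    set of pairs of an integer and a natural number generated by the shift of the
    first coordinate, by all transpositions, and by one involution for each [x]
    in [C]: the toggle of [x], which exchanges [(n, 0)] and [(n, 1)] for those
    [n] where the [n]-th bit of [x] is set.  The other orbits get the trivial
    group.  The arrows are the triples [(x, y, g)] with
    [x] and [y] in one orbit and [g] in its group, composed in the obvious way.
    Then
    - conjugation by transpositions gives icc ([icc_bundle]);
    - there are nontrivial loops, so this is not an equivalence relation
      ([bundle_not_eqv_rel]);
    - an isomorphism with a transformation groupoid would give, at each point
      [x], an injective homomorphism from the group of the orbit of [x] to a
      fixed countable group.  The [m]-th bit of [x] is recovered from whether a
      certain transposition commutes with the conjugate of the toggle of [x] by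
      the [m]-th power of the shift ([far_toggle_commute]), hence [x] is
      recovered from the images of finitely many elements.  This leaves only
      countably many points [x], which is impossible
      ([bundle_not_transformation]).

    The remaining difficulty is measurability.  For the arrows to form a Borel
    set, and for the new groupoid to be non-singular, the orbits have to be
    enumerated by countably many Borel maps ([orbit_enum]).  This is the
    Lusin-Novikov theorem, which is established here up to a null set
    ([thin_countable_sections]).  A set is called thin when countably many Borel
    functions uniformize it up to a null set; if a Borel set is not thin, then
    over almost every point of a set of positive measure a Rasiowa-Sikorski
    argument, with thickness at the point as notion of forcing, produces points
    of the section outside any prescribed countable set ([generic_point]). *)

Set Implicit Arguments.
Unset Strict Implicit.
Unset Printing Implicit Defensive.

Import Order.TTheory GRing.Theory Num.Theory.
Import numFieldNormedType.Exports.

Local Open Scope classical_set_scope.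
Local Open Scope ring_scope.

(** * Borel subsets of Cantor space *)

Section bits.
Context (I : Type).

Definition cylinder (i : I) : set (I -> bool) := [set b | b i].

(** Cantor space.  Coordinates range over an arbitrary type, so that points of
    products and of function spaces are coded without any pairing function. *)
Definition bits := g_sigma_algebraType (range cylinder).

HB.instance Definition _ := Measurable.on bits.

Lemma measurable_cylinder (i : I) : measurable ([set b | b i] : set bits).
Proof. by apply: sub_sigma_algebra; exists i. Qed.

Lemma measurable_fun_bits d (T : measurableType d) (f : T -> bits) :
  (forall i, measurable [set x | f x i]) -> measurable_fun setT f.
Proof.
move=> mf; apply: (@measurability _ _ T bits setT f (range cylinder)) => //.
by move=> _ [_ [i _ <-] <-]; rewrite setTI; exact: mf.
Qed.

End bits.

Section fun_space.
Context (J : Type).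

(** A synonym of the function type, with the identity as distinguished point:
    this needs no distinguished point in [J]. *)
Definition self_map := J -> J.

HB.instance Definition _ := gen_eqMixin self_map.
HB.instance Definition _ := gen_choiceMixin self_map.
HB.instance Definition _ := isPointed.Build self_map idfun.

Definition fun_gen : set (set self_map) :=
  [set A | exists j k, A = [set f | f j = k]].

Definition fun_space := g_sigma_algebraType fun_gen.

HB.instance Definition _ := Measurable.on fun_space.

Lemma measurable_fun_eval (j k : J) : measurable ([set f | f j = k] : set fun_space).
Proof. by apply: sub_sigma_algebra; exists j, k. Qed.

Lemma measurable_fun_fun_space d (T : measurableType d) (D : set T) (f : T -> fun_space) :
  (forall j k, measurable (D `&` [set x | f x j = k])) -> measurable_fun D f.
Proof.
move=> mf; apply: (@measurability _ _ T fun_space D f fun_gen) => //.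
by move=> _ [_ [j [k ->]] <-]; exact: mf.
Qed.

End fun_space.

(** Standard Borel spaces seen as Borel subsets of Cantor space.  A point is
    then the list of its answers to countably many yes-no questions, which is
    the form in which the constructions below consume points. *)
Definition cantor_coded d (X : measurableType d) : Prop :=
  exists (I : countType) (c : X -> bits I),
    [/\ injective c, measurable_fun setT c, measurable (range c)
      & forall A : set X, measurable A -> exists2 B : set (bits I),
          measurable B & A = c @^-1` B].

Lemma measurable_pre d d' (X : measurableType d) (Y : measurableType d')
  (f : X -> Y) (B : set Y) : measurable_fun setT f -> measurable B ->
  measurable (f @^-1` B).
Proof. by move=> mf mB; rewrite -[X in measurable X]setTI; exact: mf. Qed.

Lemma preimage_generated (X : Type) d (Y : measurableType d) (c : X -> Y)
    (G : set (set X)) :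
  (forall A, G A -> exists2 B, measurable B & A = c @^-1` B) ->
  forall A, <<s G >> A -> exists2 B, measurable B & A = c @^-1` B.
Proof.
move=> cG.
have pE : [set A | exists2 B, measurable B & A = c @^-1` B] =
    preimage_set_system setT c measurable.
  by apply/seteqP; split=> [_ [B mB ->]|_ [B mB <-]]; exists B => //; rewrite setTI.
have sG : sigma_algebra setT [set A | exists2 B, measurable B & A = c @^-1` B].
  by rewrite pE; apply: sigma_algebra_preimage; exact: sigma_algebra_measurable.
exact: (@smallest_sub _ _ G _ sG cG).
Qed.

Section sub_space.
Context d (T : measurableType d) (A : set T) (a0 : A !=set0).

(** The witness [a0] is a parameter so that the subspace is inhabited. *)
Definition sub_points : Type := let _ := a0 in set_type A.

HB.instance Definition _ := Choice.on sub_points.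

Lemma sub_point : sub_points.
Proof. by have [a Aa] := cid a0; exact: (exist _ a (mem_set Aa)). Qed.

HB.instance Definition _ := isPointed.Build sub_points sub_point.

Definition sub_space := g_sigma_algebra_preimageType
  (fun p : sub_points => \val p : T).

HB.instance Definition _ := Measurable.on sub_space.

Definition sub_val (p : sub_space) : T := \val p.

Lemma sub_valP (p : sub_space) : A (sub_val p).
Proof. exact: set_mem (valP p). Qed.

Definition to_sub x (Ax : A x) : sub_space := exist _ x (mem_set Ax).

Lemma sub_val_inj : injective sub_val.
Proof. exact: val_inj. Qed.

Lemma sub_val_measurable : measurable_fun setT sub_val.
Proof. by move=> _ B mB; rewrite setTI; exists B => //; rewrite setTI. Qed.

Lemma measurable_subE (B : set sub_space) : measurable B ->
  exists2 C, measurable C & B = sub_val @^-1` C.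
Proof. by case=> C mC <-; exists C => //; rewrite setTI. Qed.

Lemma measurable_fun_sub d' (Y : measurableType d') (D : set Y) (f : Y -> sub_space) :
  measurable_fun D (sub_val \o f) -> measurable_fun D f.
Proof. by move=> mf mD B /measurable_subE[C mC ->]; exact: mf. Qed.

End sub_space.

Section cantor_coded_closure.
Context d (X : measurableType d).

Lemma cantor_coded_sub (A : set X) (a0 : A !=set0) : cantor_coded X ->
  measurable A -> cantor_coded (sub_space a0).
Proof.
move=> [I [c [ic mc rc sc]]] mA; exists I, (c \o @sub_val _ _ _ a0); split.
- by apply: inj_comp => //; exact: sub_val_inj.
- apply: measurableT_comp => //; exact: sub_val_measurable.
- have [B mB AB] := sc _ mA.
  rewrite (_ : range _ = B `&` range c); first exact: measurableI.
  apply/seteqP; split=> [_ [p _ <-]|y [+ [x _ xy]]]; last rewrite -{}xy.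
    split; last by exists (sub_val p).
    have pB : (A `<=` c @^-1` B) by rewrite -AB.
    exact: pB (sub_valP p).
  move=> Bx; have Ax : A x by rewrite AB.
  by exists (to_sub a0 Ax).
- move=> B /measurable_subE[C /sc[D mD ->] ->].
  by exists D.
Qed.

Lemma cantor_coded_prod d' (Y : measurableType d') :
  cantor_coded X -> cantor_coded Y -> cantor_coded (X * Y)%type.
Proof.
move=> [I [c [ic mc rc sc]]] [J [e [ie me re se]]].
pose f (p : X * Y) : bits (I + J)%type :=
  fun k => match k with inl i => c p.1 i | inr j => e p.2 j end.
pose l (b : bits (I + J)%type) : bits I := fun i => b (inl i).
pose r (b : bits (I + J)%type) : bits J := fun j => b (inr j).
have ml : measurable_fun setT l.
  by apply: measurable_fun_bits => i; exact: (measurable_cylinder (inl i : I + J)%type).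
have mr : measurable_fun setT r.
  by apply: measurable_fun_bits => i; exact: (measurable_cylinder (inr i : I + J)%type).
exists (I + J)%type, f; split.
- move=> [x y] [x' y'] fE; congr pair.
    by apply: ic; exact: (congr1 l fE).
  by apply: ie; exact: (congr1 r fE).
- apply: measurable_fun_bits => -[i|j] /=.
  + apply: (@measurable_pre _ _ _ _ (c \o fst) [set b | b i]).
      exact: measurableT_comp.
    exact: measurable_cylinder.
  + apply: (@measurable_pre _ _ _ _ (e \o snd) [set b | b j]).
      exact: measurableT_comp.
    exact: measurable_cylinder.
- rewrite (_ : range f = l @^-1` range c `&` r @^-1` range e).
    by apply: measurableI; exact: measurable_pre.
  apply/seteqP; split=> [_ [p _ <-]|b [[x _ xb] [y _ yb]]].
    by split; [exists p.1|exists p.2].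
  exists (x, y) => //; apply/funext => -[i|j] /=.
    exact: (congr1 (@^~ i) xb).
  exact: (congr1 (@^~ j) yb).
- apply: preimage_generated => A [[A1 /sc[B mB A1E] <-]|[A1 /se[B mB A1E] <-]].
    by exists (l @^-1` B); [exact: measurable_pre|rewrite setTI A1E].
  by exists (r @^-1` B); [exact: measurable_pre|rewrite setTI A1E].
Qed.

Lemma cantor_coded_image (A : set X) (I : countType) (c : X -> bits I) :
  injective c -> measurable (range c) ->
  (exists2 B : set (bits I), measurable B & A = c @^-1` B) ->
  measurable (c @` A).
Proof.
move=> ic mc [B mB ->]; rewrite (_ : _ @` _ = B `&` range c); first exact: measurableI.
apply/seteqP; split=> [_ [x Bx <-]|y [By [x _ xy]]]; first by split => //; exists x.
by exists x => //; rewrite /preimage/= xy.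
Qed.

End cantor_coded_closure.

Lemma measurable_const d (X : measurableType d) (P : Prop) :
  measurable [set _ : X | P].
Proof.
have [p|np] := pselect P.
  by rewrite (_ : mkset _ = setT) //; apply/seteqP; split.
by rewrite (_ : mkset _ = set0) //; apply/seteqP; split.
Qed.

Lemma measurable_exists d (X : measurableType d) (J : countType) (F : J -> set X) :
  (forall j, measurable (F j)) -> measurable [set x | exists j, F j x].
Proof.
move=> mF; rewrite (_ : [set x | _] = \bigcup_j F j); last first.
  by apply/seteqP; split=> x /= [j]; [exists j|move=> _ Fj; exists j].
by apply: countable_bigcupT_measurable => //; exact: countableP.
Qed.

Lemma measurable_forall d (X : measurableType d) (J : countType) (F : J -> set X) :
  (forall j, measurable (F j)) -> measurable [set x | forall j, F j x].
Proof.
move=> mF; rewrite (_ : [set x | _] = ~` [set x | exists j, (~` F j) x]); last first.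
  by apply/seteqP; split=> x /=; [move=> h [j /(_ (h j))]|move=> /forallNP h j; exact: contrapT (h j)].
by apply: measurableC; apply: measurable_exists => j; exact: measurableC.
Qed.

Lemma measurable_imply d (X : measurableType d) (A B : set X) :
  measurable A -> measurable B -> measurable [set x | A x -> B x].
Proof.
move=> mA mB; rewrite (_ : [set x | _] = ~` A `|` B).
  by apply: measurableU => //; exact: measurableC.
apply/seteqP; split=> x /=; last by move=> [].
by move=> AB; have [/AB|] := pselect (A x); [right|left].
Qed.

(** A self-map is coded by its graph, and the condition of being a graph is a
    countable combination of conditions on single bits. *)
Lemma cantor_coded_fun_space (J : countType) : cantor_coded (fun_space J).
Proof.
pose c (f : fun_space J) : bits (J * J)%type := fun p => `[< f p.1 = p.2 >].
exists (J * J)%type, c; split.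
- move=> f g fg; apply/funext => j; have := congr1 (@^~ (j, f j)) fg => /=.
  by rewrite /c /= asboolT// => /esym/asboolP ->.
- apply: measurable_fun_bits => -[j k]; rewrite /c /=.
  rewrite (_ : [set x | _] = [set f | f j = k]); first exact: measurable_fun_eval.
  by apply/seteqP; split=> f /=; [move/asboolP|move=> ?; exact/asboolP].
- rewrite (_ : range c = [set b | forall j : J, exists k : J,
      b (j, k) /\ forall k', k' == k \/ ~ b (j, k')]).
    apply: measurable_forall => j.
    apply: measurable_exists => k.
    apply: measurableI; first exact: measurable_cylinder.
    apply: measurable_forall => k'; apply: measurableU.
      exact: measurable_const.
    by apply: measurableC; exact: measurable_cylinder.
  apply/seteqP; split=> [_ [f _ <-] j|b /choice[f fP]].
    exists (f j); rewrite /c /=; split; first exact/asboolP.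
    move=> k; have [->|ne] := eqVneq k (f j); [by left|right].
    by move/asboolP => /esym/eqP; exact/negP.
  exists f => //; apply/funext => -[j k]; rewrite /c /=.
  have [bj bn] := fP j.
  have [<-|/eqP ne] := eqVneq (f j) k; first by rewrite asboolT// bj.
  rewrite asboolF//; apply/esym/negbTE/negP; have [/eqP e|//] := bn k.
  by rewrite e in ne.
- apply: preimage_generated => _ [j [k ->]]; exists [set b | b (j, k)]; first exact: measurable_cylinder.
  by apply/seteqP; split=> f /=; rewrite /c /=; [move=> ->; exact/asboolP|move/asboolP].
Qed.

(** * Standard Borel spaces and Cantor space *)

Lemma countable_enum (T : Type) (D : set T) (x0 : T) : D x0 -> countable D ->
  exists2 q : nat -> T, (forall n, D (q n)) & forall x, D x -> exists n, q n = x.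
Proof.
move=> Dx0 /countable_injP[f finj].
have qP n : exists x, D x /\ ((exists y, D y /\ f y = n) -> f x = n).
  have [[y [Dy fy]]|h] := pselect (exists y, D y /\ f y = n); first by exists y.
  by exists x0; split.
have [q {}qP] := choice qP.
exists q => [n|x Dx]; first by have [] := qP n.
have [Dq fq] := qP (f x).
by exists (f x); apply: finj; rewrite ?inE//; apply: fq; exists x.
Qed.

Lemma countable_setU (T : Type) (A B : set T) :
  countable A -> countable B -> countable (A `|` B).
Proof.
by move=> cA cB; rewrite -bigcup2E; apply: bigcup_countable => // -[|[|n]].
Qed.

Lemma countable_image (T U : Type) (f : T -> U) (A : set T) :
  countable A -> countable (f @` A).
Proof. by move=> cA; exact: card_le_trans (card_image_le _ _) cA. Qed.

Section standard_borel_cantor_coded.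
Context (R : realType) d (X : measurableType d).

Let ratrS (k : nat) : ratr (k.+1%:R^-1 : rat) = k.+1%:R^-1 :> R.
Proof. by rewrite fmorphV /= ratr_nat. Qed.

Section metric_code.
Context (M : metricType R) (q : nat -> M).
Hypothesis qD : forall m (e : R), (0 < e)%R -> exists n, (mdist m (q n) < e)%R.
Hypothesis complete : forall F : set_system M, ProperFilter F -> cauchy F ->
  exists l : M, F --> l.

Let code (m : M) : bits (nat * rat)%type :=
  fun k => (mdist (q k.1) m < ratr k.2)%R.

Let code_inj : injective code.
Proof.
move=> x y xy; apply: contrapT => /eqP ne.
have d0 : (0 < mdist x y)%R by rewrite mdist_gt0.
have d4 : (0 < mdist x y / 4)%R by lra.
have [n xn] := qD x d4.
have : (mdist x y / 4 < mdist x y / 2)%R by lra.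
move=> /rat_in_itvoo[p]; rewrite in_itv/= => /andP[p1 p2].
have := congr1 (@^~ (n, p)) xy; rewrite /code /= [mdist _ x]metric_sym (lt_trans xn p1).
move=> /esym yn; have := metric_triangle x (q n) y.
by move: xn p1 p2 yn {xy}; move: (mdist x (q n)) (mdist (q n) y) (mdist x y) (ratr p) => *; lra.
Qed.

Let code_open (U : set M) : open U ->
  exists2 B : set (bits (nat * rat)%type), measurable B & U = code @^-1` B.
Proof.
move=> oU; exists [set b | exists k : nat * rat,
    [set y | mdist (q k.1) y < ratr k.2]%R `<=` U /\ b k].
  apply: measurable_exists => k; apply: measurableI; first exact: measurable_const.
  exact: measurable_cylinder.
apply/seteqP; split=> m /=; last by move=> [k [kU]]; rewrite /code => /kU.
move=> Um; have : nbhs m U by exact: open_nbhs_nbhs.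
move/nbhs_ballP => [e /= e0]; rewrite ballEmdist /= => eU.
have e4 : (0 < e / 4)%R by lra.
have [n xn] := qD m e4.
have : (e / 4 < e / 2)%R by lra.
move=> /rat_in_itvoo[p]; rewrite in_itv/= => /andP[p1 p2].
exists (n, p); split=> /=; last by rewrite /code /= metric_sym (lt_trans xn p1).
move=> y /= ny; apply: eU => /=; have := metric_triangle m (q n) y.
by move: (mdist m _) (mdist _ y) (mdist m y) (ratr p) xn p1 p2 ny => *; lra.
Qed.

(** A sequence of rational cuts comes from a point exactly when the cuts are
   open, satisfy the two triangle inequalities against the dense sequence, and
   take arbitrarily small values: then the centres with small values form a
   Cauchy sequence. *)
Let code_range : range code = [set b : bits (nat * rat)%type |
  [/\ forall k : nat, exists n : nat, b (n, k.+1%:R^-1 : rat)%R,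
      forall k l : nat * rat, b k -> b l -> (mdist (q k.1) (q l.1) < ratr (k.2 + l.2))%R,
      forall (k : nat * rat) (l : nat * rat), b k ->
        (mdist (q k.1) (q l.1) < ratr l.2)%R -> b (l.1, k.2 + l.2)%R
    & forall k : nat * rat, b k -> exists p : rat, (p < k.2)%R /\ b (k.1, p)]].
Proof.
apply/seteqP; split=> [_ [m _ <-]|b [/choice[s sP] bD bL bO]].
  split=> [k|[n p] [n' p']|[n p] [n' p']|[n p]]; rewrite /code /=.
  - have [n nP] := qD m (ltac:(by rewrite invr_gt0 ltr0n) : 0 < k.+1%:R^-1 :> R)%R.
    by exists n; rewrite metric_sym ratrS.
  - move=> h1 h2; rewrite rmorphD /=; have := metric_triangle (q n) m (q n').
    by rewrite [mdist m _]metric_sym => /le_lt_trans; apply; exact: ltrD.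
  - move=> h1 h2; rewrite rmorphD /=; have := metric_triangle (q n') (q n) m.
    by rewrite [mdist (q n') (q n)]metric_sym => /le_lt_trans; apply; rewrite addrC ltrD.
  - move=> /rat_in_itvoo[p']; rewrite in_itv/= => /andP[p1 p2]; exists p'.
    by rewrite -(ltr_rat R).
pose u k := q (s k).
have [l ul] : exists l : M, u @ \oo --> l.
  apply: complete; apply: cauchy_exP => e e0.
  have e2 : (0 < e / 2)%R by lra.
  have [k] : exists k : nat, (k.+1%:R^-1 < e / 2 :> R)%R.
    have [k _ kP] := near_infty_natSinv_lt (PosNum e2).
    by exists k; apply: (kP k) => /=.
  move=> ke; exists (u k); exists k => // j /= kj.
  rewrite ballEmdist /=; have := bD _ _ (sP k) (sP j).
  rewrite /= rmorphD /= !ratrS => /lt_trans; apply.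
  have : (j.+1%:R^-1 <= k.+1%:R^-1 :> R)%R by rewrite lef_pV2 ?posrE ?ltr0n// ler_nat.
  by move: (k.+1%:R^-1)%R (j.+1%:R^-1)%R ke => *; lra.
have near e : (0 < e)%R -> exists k, (k.+1%:R^-1 < e)%R /\ (mdist l (u k) < e)%R.
  move=> e0; have /cvg_ballP/(_ e e0)[n _ nP] := ul.
  have [m _ mP] := near_infty_natSinv_lt (PosNum e0).
  exists (maxn n m); split; first by apply: mP; exact: leq_maxr.
  by have := nP (maxn n m) (leq_maxl _ _); rewrite ballEmdist.
exists l => //; apply/funext => -[n p]; rewrite /code /=; apply/idP/idP.
  move=> lp; have e0 : (0 < (ratr p - mdist (q n) l) / 2)%R by lra.
  have [k [ke le]] := near _ e0.
  have := bL (s k, k.+1%:R^-1)%R (n, p - k.+1%:R^-1)%R (sP k).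
  rewrite /= addrCA subrr addr0; apply; rewrite rmorphB /= ratrS -/(u k).
  have := metric_triangle (u k) l (q n); rewrite [mdist (u k) l]metric_sym [mdist l (q n)]metric_sym.
  move: lp ke le; move: (mdist l (u k)) (mdist (q n) l) (mdist (u k) (q n)).
by move: (ratr p) (k.+1%:R^-1)%R => *; lra.
move=> bp; have [p' /= [p'p bp']] := bO _ bp.
have e0 : (0 < (ratr p - ratr p') / 2 :> R)%R by rewrite -(ltr_rat R) in p'p; lra.
have [k [ke le]] := near _ e0.
have := bD _ _ bp' (sP k); rewrite /= rmorphD /= ratrS -/(u k).
have := metric_triangle (q n) (u k) l; rewrite [mdist (u k) l]metric_sym.
move: ke le; move: (mdist l (u k)) (mdist (q n) l) (mdist (q n) (u k)).
by move: (ratr p) (ratr p') (k.+1%:R^-1)%R => *; lra.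
Qed.

Lemma metric_cantor_code : exists c : M -> bits (nat * rat)%type,
  [/\ injective c, measurable (range c), forall k, open [set m | c m k]
    & forall U : set M, open U ->
      exists2 B : set (bits (nat * rat)%type), measurable B & U = c @^-1` B].
Proof.
exists code; split=> //; last first.
  move=> k; rewrite openE => y /= yk; apply/nbhs_ballP.
  exists (ratr k.2 - mdist (q k.1) y) => /=; first by rewrite subr_gt0.
  rewrite !ballEmdist /code => z /= yz; rewrite (le_lt_trans (metric_triangle _ y _))//.
  by rewrite addrC -ltrBrDr.
rewrite code_range.
rewrite [X in measurable X](_ : _ = [set b : bits (nat * rat)%type | forall k : nat, exists n : nat,
      b (n, k.+1%:R^-1 : rat)%R] `&`
   ([set b : bits (nat * rat)%type | forall k l : nat * rat, b k -> b l -> (mdist (q k.1) (q l.1) < ratr (k.2 + l.2))%R] `&`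
   ([set b : bits (nat * rat)%type | forall (k : nat * rat) (l : nat * rat), b k ->
        (mdist (q k.1) (q l.1) < ratr l.2)%R -> b (l.1, k.2 + l.2)%R] `&`
   [set b : bits (nat * rat)%type | forall k : nat * rat, b k -> exists p : rat, (p < k.2)%R /\ b (k.1, p)]))); last first.
  apply/seteqP; split=> b /=.
    by case=> ? ? ? ?; split => //; split => //; split.
  by move=> [? [? [? ?]]]; split.
apply: measurableI; [|apply: measurableI; [|apply: measurableI]].
- apply: measurable_forall => k; apply: measurable_exists => n; exact: measurable_cylinder.
- apply: measurable_forall => k; apply: measurable_forall => l.
  apply: measurable_imply; first exact: measurable_cylinder.
  apply: measurable_imply; first exact: measurable_cylinder.
  exact: measurable_const.
- apply: measurable_forall => k; apply: measurable_forall => l.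
  apply: measurable_imply; first exact: measurable_cylinder.
  apply: measurable_imply; first exact: measurable_const.
  exact: measurable_cylinder.
- apply: measurable_forall => k.
  apply: measurable_imply; first exact: measurable_cylinder.
  apply: measurable_exists => p; apply: measurableI; first exact: measurable_const.
  exact: measurable_cylinder.
Qed.

End metric_code.

Lemma sigma_algebra_setI (T : Type) (G : set (set T)) A B :
  <<s G >> A -> <<s G >> B -> <<s G >> (A `&` B).
Proof.
move=> sA sB; rewrite -[A `&` B]setCK setCI -bigcup2E.
rewrite -setTD; apply: sigma_algebraCD; apply: sigma_algebra_bigcup => -[|[|n]] /=.
- by rewrite -setTD; exact: sigma_algebraCD.
- by rewrite -setTD; exact: sigma_algebraCD.
- exact: sigma_algebra0.
Qed.

(** A point is coded by the rational balls around a dense sequence that contain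
    it. *)
Lemma standard_borel_cantor_coded : standard_borel R X -> cantor_coded X.
Proof.
move=> [M [f [cM [D cD dD] finj mf]]].
have [x0 Dx0] : exists x, D x.
  have [x []] := dD setT (ltac:(by exists (f point))) openT; by exists x.
have [q qD Dq] := countable_enum Dx0 cD.
have qdense m (e : R) : (0 < e)%R -> exists n, (mdist m (q n) < e)%R.
  move=> e0; have ob : open (ball m e).
    rewrite openE => y; rewrite ballEmdist /= => ye; apply/nbhs_ballP.
    exists (e - mdist m y)%R => /=; first by rewrite subr_gt0.
    rewrite !ballEmdist => z /= yz; rewrite (le_lt_trans (metric_triangle _ y _))//.
    by rewrite addrC -ltrBrDr.
  have [y [+ /Dq[n qn]]] := dD (ball m e) (ltac:(by exists m; exact: ballxx)) ob.
  by rewrite ballEmdist -qn /=; exists n.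
have [c [ic mc oc co]] := metric_cantor_code qdense cM.
have cs := preimage_generated co.
exists (nat * rat)%type, (c \o f); split.
- exact: inj_comp.
- apply: measurable_fun_bits => k; apply/mf.
  rewrite (_ : _ @` _ = [set m | c m k] `&` f @` setT); last first.
    apply/seteqP; split=> [_ [x xk <-]|m [mk [x _ xm]]]; first by split => //; exists x.
    by exists x => //; rewrite /= xm.
  by apply: sigma_algebra_setI; [exact: sub_sigma_algebra|exact/mf].
- have [B mB BE] := cs _ ((mf setT).1 measurableT).
  rewrite (_ : range _ = B `&` range c); first exact: measurableI.
  apply/seteqP; split=> [_ [x _ <-]|b [Bb [m _ mb]]].
    split; last by exists (f x).
    have fB : (f @` [set: X] `<=` c @^-1` B) by rewrite BE.
    by apply: fB; exists x.
  have Bm : (c @^-1` B) m by rewrite /preimage /= mb.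
  have fB : (c @^-1` B `<=` f @` [set: X]) by rewrite BE.
  by have [x _ xm] := fB m Bm; exists x => //=; rewrite xm mb.
- move=> A /mf /cs[B mB BE]; exists B => //.
  apply/seteqP; split=> x /=.
    move=> Ax; have : (f @` A) (f x) by exists x.
    by rewrite BE.
  by move=> Bx; have [y Ay /finj <-] : (f @` A) (f x) by rewrite BE.
Qed.

End standard_borel_cantor_coded.

Section cantor_coded_standard_borel.
Context (R : realType).

Fixpoint ternary_sum (n : nat) (b : bits nat) : R :=
  if n is m.+1 then (b 0%N)%:R + ternary_sum m (fun k => b k.+1) / 3 else 0.

Let ternary_sumS n b :
  ternary_sum n.+1 b = (b 0%N)%:R + ternary_sum n (fun k => b k.+1) / 3.
Proof. by []. Qed.

Let ternary_sum_bound n b : 0 <= ternary_sum n b <= 3 / 2.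
Proof.
elim: n b => [|n IHn] b /=; first by apply/andP; split; lra.
have /andP[h1 h2] := IHn (fun k => b k.+1).
by case: (b 0%N) => /=; apply/andP; split; lra.
Qed.

Let ternary_sum_nd b : {homo (ternary_sum^~ b) : n m / (n <= m)%N >-> n <= m}.
Proof.
apply: homo_leq => [x|y x z|n]; [exact: lexx|exact: le_trans|].
elim: n b => [|n IHn] b.
  by rewrite /=; case: (b 0%N) => /=; lra.
by have := IHn (fun k => b k.+1); rewrite (ternary_sumS n.+1 b) (ternary_sumS n b); lra.
Qed.

(** The sum of the [b n / 3 ^ n].  The digits are 0 and 1 and the base is 3, so
    that a tail starting at the second digit is at most 1/2 and the first digit
    can be recovered by comparing with 1. *)
Definition ternary (b : bits nat) : R := limn (ternary_sum^~ b).

Let cvg_ternary b : ternary_sum^~ b @ \oo --> ternary b.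
Proof.
apply: nondecreasing_is_cvgn; first exact: ternary_sum_nd.
by exists (3 / 2) => _ [n _ <-]; have /andP[] := ternary_sum_bound n b.
Qed.

Let ternary_bound b : 0 <= ternary b <= 3 / 2.
Proof.
apply/andP; split.
  apply: limr_ge; first by apply/cvg_ex; exists (ternary b); exact: cvg_ternary.
  by apply: nearW => n; have /andP[] := ternary_sum_bound n b.
apply: limr_le; first by apply/cvg_ex; exists (ternary b); exact: cvg_ternary.
by apply: nearW => n; have /andP[] := ternary_sum_bound n b.
Qed.

Let ternaryE b : ternary b = (b 0%N)%:R + ternary (fun k => b k.+1) / 3.
Proof.
have h : (fun n => ternary_sum n.+1 b) @ \oo --> ternary b.
  by have := @cvg_ternary b; rewrite -cvg_shiftS.
apply: (cvg_unique (@Rhausdorff R) h) => /=.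
apply: cvgD; first exact: cvg_cst.
by apply: cvgMl; exact: cvg_ternary.
Qed.

Let tail (r : R) : R := 3 * (r - (1 <= r)%R%:R).

Definition digits (r : R) : bits nat := fun n => 1 <= iter n tail r.

Lemma ternaryK : cancel ternary digits.
Proof.
have first_digit b : (1 <= ternary b) = b 0%N.
  rewrite ternaryE; have /andP[h1 h2] := ternary_bound (fun k => b k.+1).
  by case: (b 0%N) => /=; [apply/idP|apply/negbTE; rewrite -ltNge]; lra.
move=> b; apply/funext => n; rewrite /digits.
have -> : iter n tail (ternary b) = ternary (fun k => b (n + k)%N).
  elim: n => [//|n IHn]; rewrite iterS IHn /tail first_digit addn0.
  rewrite ternaryE addn0 addrC addKr mulrC divfK ?pnatr_eq0//.
  by congr ternary; apply/funext => k; rewrite addSnnS.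
by rewrite first_digit addn0.
Qed.

Lemma measurable_ternary : measurable_fun setT ternary.
Proof.
apply: (@measurable_fun_cvg _ _ _ _ ternary_sum) => [n|b _]; last exact: cvg_ternary.
elim: n => [|n IHn] //=.
apply: measurable_funD.
  apply: (@measurableT_comp _ _ _ _ _ _ (fun c : bool => c%:R : R)) => //.
  by apply: (measurable_fun_bool true); rewrite setTI; exact: measurable_cylinder.
apply: (@measurable_funM _ _ _ _ (fun b : bits nat => ternary_sum n (fun k => b k.+1))) => //.
apply: (@measurableT_comp _ _ _ _ _ _ (ternary_sum n)) => //.
by apply: measurable_fun_bits => k; exact: (measurable_cylinder k.+1).
Qed.

Lemma measurable_digits : measurable_fun setT digits.
Proof.
apply: measurable_fun_bits => n.
have mtail : measurable_fun setT tail.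
  apply: measurable_funM => //; apply: measurable_funB => //.
  apply: (@measurableT_comp _ _ _ _ _ _ (fun c : bool => c%:R : R)) => //.
  exact: measurable_fun_ler.
have mi : measurable_fun setT (iter n tail).
  by elim: n => [|n IHn]; [exact: measurable_id|exact: (measurableT_comp mtail IHn)].
rewrite (_ : [set x | _] = iter n tail @^-1` `[1, +oo[).
  exact: measurable_pre.
by apply/seteqP; split=> x /=; rewrite in_itv/= andbT.
Qed.

Lemma bits_reindex (I : countType) : exists c : bits I -> bits nat,
  [/\ injective c, measurable_fun setT c & forall B : set (bits I), measurable B ->
    measurable (c @` B)].
Proof.
pose c (b : bits I) : bits nat := fun n => if unpickle n is Some i then (n == pickle i) && b i else false.
pose e (b : bits nat) : bits I := fun i => b (pickle i).
have ce : cancel c e by move=> b; apply/funext => i; rewrite /e /c pickleK eqxx.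
have mc : measurable_fun setT c.
  apply: measurable_fun_bits => n; rewrite /c; case: (unpickle n) => [i|]; last exact: measurable_const.
  case: (n == pickle i) => /=; last exact: measurable_const.
  exact: measurable_cylinder.
have me : measurable_fun setT e.
  by apply: measurable_fun_bits => i; exact: (measurable_cylinder (pickle i)).
exists c; split=> // [|B mB]; first exact: can_inj ce.
rewrite (_ : c @` B = e @^-1` B `&` [set b | forall n, c (e b) n = b n]).
  apply: measurableI; first exact: measurable_pre.
  apply: measurable_forall => n.
  rewrite [X in measurable X](_ : _ = [set b | (c (e b) n -> b n) /\ (b n -> c (e b) n)]).
    have mce : measurable [set b : bits nat | c (e b) n].
      apply: (@measurable_pre _ _ _ _ (c \o e) [set b | b n]).
        exact: measurableT_comp.
      exact: measurable_cylinder.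
    by apply: measurableI; apply: measurable_imply => //; exact: measurable_cylinder.
  by apply/seteqP; split=> b /=; [move=> ->|move=> [h1 h2]; exact/idP/idP].
apply/seteqP; split=> [_ [b Bb <-]|b [Bb cb]].
  by split=> /=; rewrite /preimage/= ce.
by exists (e b) => //; apply/funext.
Qed.

(** A Borel injection with a Borel left inverse maps Borel sets to Borel sets:
    the image of [A] consists of the reals whose digits lie in the code of [A]
    and which are the sum of their digits. *)
Lemma cantor_coded_standard_borel d (X : measurableType d) :
  cantor_coded X -> standard_borel R X.
Proof.
move=> [I [c [ic mc rc sc]]]; have [e [ie me se]] := bits_reindex I.
pose f := ternary \o e \o c.
have finj : injective f.
  by apply: inj_comp => //; apply: inj_comp => //; exact: can_inj ternaryK.
have mf : measurable_fun setT f.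
  apply: measurableT_comp => //; apply: measurableT_comp => //.
  exact: measurable_ternary.
have openE : <<s @open R^o >> = @measurable _ R.
  apply/seteqP; split.
    apply: smallest_sub; first exact: sigma_algebra_measurable.
    by move=> U oU; exact: open_measurable.
  have -> : @measurable _ R = (@RGenOpens.G R).-sigma.-measurable.
    by rewrite -RGenOpens.measurableE.
  apply: smallest_sub; first exact: smallest_sigma_algebra.
  move=> _ [x [y ->]]; apply: sub_sigma_algebra.
  exact: interval_open.
exists R^o, f; split=> //.
- by move=> F FF cF; exists (lim F); exact: cauchy_cvg.
- exists (range ratr); last exact: dense_rat.
  by apply: countable_image; exact: countableP.
move=> A; rewrite openE; split=> [mA|mfA]; last first.
  rewrite (_ : A = f @^-1` (f @` A)); first exact: measurable_pre.
  by apply/seteqP; split=> [x Ax|x [y Ay /finj <-]//]; exists x.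
have mB : measurable (e @` (c @` A)) by apply: se; exact: cantor_coded_image (sc _ mA).
rewrite (_ : f @` A = digits @^-1` (e @` (c @` A)) `&`
    [set r | ternary (digits r) == r]); last first.
  apply/seteqP; split=> [_ [x Ax <-]|r [[_ [x Ax <-] xr] /eqP rE]].
    have fx : digits (f x) = e (c x) by exact: ternaryK.
    split; rewrite /preimage /= fx //; exists (c x) => //; by exists x.
  by exists x => //; rewrite /f /= xr.
apply: measurableI; first by apply: measurable_pre => //; exact: measurable_digits.
rewrite (_ : mkset _ = (fun r => ternary (digits r) == r) @^-1` [set true]).
  apply: measurable_pre => //; apply: measurable_fun_eqr => //.
  by apply: measurableT_comp; [exact: measurable_ternary|exact: measurable_digits].
by [].
Qed.

End cantor_coded_standard_borel.

(** * Thin sets *)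

Lemma ae_forall_countType (R : realType) d (X : measurableType d)
    (mu : {measure set X -> \bar R}) (J : countType) (P : J -> X -> Prop) :
  (forall j, \forall x \ae mu, P j x) -> \forall x \ae mu, forall j, P j x.
Proof.
move=> aeP; have := @ae_foralln _ _ _ mu
  (fun n x => forall j : J, unpickle n = Some j -> P j x).
move=> /(_ _)/filterS; apply.
  by move=> x h j; apply: (h (pickle j)); exact: pickleK.
move=> n; case: (unpickle n) => [j|]; last by apply: aeW.
by apply: filterS (aeP j) => x Px _ [<-].
Qed.

Section exhaustion.
Context (R : realType) d (X : measurableType d) (mu : probability X R).

(** Exhaustion: a union of members of [P] whose measures tend to the supremum
    is a largest one, up to null sets. *)
Lemma max_region (P : set X -> Prop) :
  P set0 -> (forall D : nat -> set X, (forall n, P (D n)) -> P (\bigcup_n D n)) ->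
  exists M, [/\ measurable M, P M & forall D, measurable D -> P D -> mu (D `\` M) = 0%E].
Proof.
move=> P0 PU.
pose S := [set mu D | D in [set D | measurable D /\ P D]].
have S0 : S 0%E by exists set0 => //; rewrite measure0.
have Sub x : S x -> (x <= 1)%E by move=> [D [mD _] <-]; exact: probability_le1.
pose s := ereal_sup S.
have s1 : (s <= 1)%E by apply: ge_ereal_sup => x /Sub.
have s0 : (0 <= s)%E by exact: ereal_sup_ubound.
have sfin : s \is a fin_num.
  by rewrite fin_numE; apply/andP; split; [rewrite gt_eqF// (lt_le_trans _ s0)|rewrite lt_eqF// (le_lt_trans s1) ?ltry].
have approx n : exists D, [/\ measurable D, P D & (s - n.+1%:R^-1%:E < mu D)%E].
  have [_ [D [mD PD] <-] h] := ub_ereal_sup_adherent (ltac:(by rewrite invr_gt0 ltr0n) : 0 < n.+1%:R^-1 :> R) sfin.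
  by exists D.
have [D DP] := choice approx.
have mU : measurable (\bigcup_n D n) by apply: bigcupT_measurable => n; have [] := DP n.
have PD : P (\bigcup_n D n) by apply: PU => n; have [] := DP n.
exists (\bigcup_n D n); split=> // E mE PE.
have sU : (s <= mu (\bigcup_n D n))%E.
  apply/lee_addgt0Pr => e e0; have [n _ nP] := near_infty_natSinv_lt (PosNum e0).
  have [mDn _ h] := DP n; have := nP n (leqnn _) => /= ne.
  rewrite -leeBlDr//; apply: le_trans (le_trans (ltW h) _).
    by rewrite leeB// lee_fin ltW.
  by apply: le_measure; rewrite ?inE//; exact: bigcup_sup.
set M := \bigcup_n D n in mU PD sU *.
have : (mu (E `\` M `|` M) <= s)%E.
  rewrite (_ : _ `|` _ = E `|` M); last first.
    apply/seteqP; split=> x; first by move=> [[]|]; [left|right].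
    by have [|] := pselect (M x); [right|move=> nM [Ex|//]; left].
  apply: ereal_sup_ubound; exists (E `|` M) => //; split.
    exact: measurableU.
  by rewrite -bigcup2E; apply: PU => -[|[|k]].
rewrite measureU//; last 2 first.
- exact: measurableD.
- by rewrite setDE -setIA [~` _ `&` _]setIC setICr setI0.
have Mfin : mu M \is a fin_num by exact: fin_num_measure.
move=> h; have := le_trans h sU; rewrite -leeBrDr// subee// => h0.
by apply/eqP; rewrite eq_le h0 measure_ge0.
Qed.

End exhaustion.

Section thin.
Context (R : realType) d (X : measurableType d) (mu : probability X R).

Section thin_ideal.
Context d' (Y : measurableType d').

(** The conclusion of the uniformization theorem, up to a null set of the base.
    Thin sets form a sigma-ideal that behaves well under restriction of the
    base, so that how large a set is can be asked point by point. *)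
Definition thin (A : set (X * Y)) : Prop := exists F : set (X -> Y),
  [/\ countable F, forall f, F f -> measurable_fun setT f
    & mu.-negligible [set x | exists y, A (x, y) /\ forall f, F f -> y <> f x]].

Lemma thinS A B : B `<=` A -> thin A -> thin B.
Proof.
move=> BA [F [cF mF nF]]; exists F; split=> //.
by apply: negligibleS nF => x [y [/BA Axy h]]; exists y.
Qed.

Lemma thin_bigcup (A : nat -> set (X * Y)) : (forall n, thin (A n)) ->
  thin (\bigcup_n A n).
Proof.
move=> /choice[F FP]; exists (\bigcup_n F n); split.
- by apply: bigcup_countable => // n _; have [] := FP n.
- by move=> f [n _ Fnf]; have [_ + _] := FP n; apply.
- apply: (@negligibleS _ _ _ _ (\bigcup_n [set x | exists y, A n (x, y) /\ forall f, F n f -> y <> f x])).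
    by move=> x [y [[n _ Any] h]]; exists n => //; exists y; split=> // f Fnf; apply: h; exists n.
  by apply: negligible_bigcup => n; have [] := FP n.
Qed.

Lemma thin_negligible (N : set X) (A : set (X * Y)) : mu.-negligible N ->
  (forall x y, A (x, y) -> N x) -> thin A.
Proof.
move=> nN AN; exists set0; split=> //.
by apply: negligibleS nN => x [y [/AN]].
Qed.

Lemma thin0 : thin set0.
Proof. by apply: (@thin_negligible set0) => //; exact: negligible_set0. Qed.

Lemma thin_exists (J : countType) (A : set (X * Y)) (B : J -> set (X * Y)) :
  (forall j, thin (B j)) -> (forall z, A z -> exists j, B j z) -> thin A.
Proof.
move=> tB AB; pose C n := if unpickle n is Some j then B j else set0.
apply: (@thinS (\bigcup_n C n)).
  by move=> z /AB[j Bj]; exists (pickle j) => //; rewrite /C pickleK.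
by apply: thin_bigcup => n; rewrite /C; case: (unpickle n) => [j|] //; exact: thin0.
Qed.

Lemma thin_graph (f : X -> Y) (A : set (X * Y)) : measurable_fun setT f ->
  (forall x y, A (x, y) -> y = f x) -> thin A.
Proof.
move=> mf Af; exists [set f]; split.
- exact: countable1.
- by move=> _ ->.
- rewrite (_ : mkset _ = set0); first exact: negligible_set0.
  by apply/seteqP; split=> x //= [y [/Af yE /(_ f)]]; apply.
Qed.

Definition above (A : set (X * Y)) (D : set X) : set (X * Y) :=
  [set z | A z /\ D z.1].

Lemma thick_exists (A : set (X * Y)) : exists N, [/\ measurable N,
  thin (above A (~` N)) &
  forall D, measurable D -> thin (above A D) -> mu (D `&` N) = 0%E].
Proof.
have [||M [mM tM maxM]] := @max_region R d X mu (fun D => thin (above A D)).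
- by apply: thinS thin0 => z [].
- move=> D tD; apply: thinS (thin_bigcup tD).
  by move=> z [Az [n _ Dn]]; exists n.
- exists (~` M); split; [exact: measurableC|by rewrite setCK|].
  by move=> D mD tD; rewrite -setDE; exact: maxM.
Qed.

(** The part of the base over which [A] is nowhere thin. *)
Definition thick (A : set (X * Y)) : set X := projT1 (cid (thick_exists A)).

Lemma measurable_thick A : measurable (thick A).
Proof. by rewrite /thick; case: cid => N []. Qed.

Lemma thin_thick A : thin (above A (~` thick A)).
Proof. by rewrite /thick; case: cid => N []. Qed.

Lemma thick_thin A D : measurable D -> thin (above A D) -> mu (D `&` thick A) = 0%E.
Proof. by rewrite /thick; case: cid => N [mN tN h] mD; exact: h. Qed.

(** Over the points where no [B j] is thick, [A] is covered by countably many
    thin sets, so that these points are almost never in [thick A].  The case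
    without any [j] says that the empty set is nowhere thick. *)
Lemma ae_thick_cover (J : countType) (P : J -> Prop) (A : set (X * Y)) (B : J -> set (X * Y)) :
  (forall z, A z -> exists j, P j /\ B j z) ->
  \forall x \ae mu, thick A x -> exists j, P j /\ thick (B j) x.
Proof.
move=> AB; pose D := [set x | forall j, P j -> (~` thick (B j)) x].
have mD : measurable D.
  apply: measurable_forall => j; apply: measurable_imply; first exact: measurable_const.
  by apply: measurableC; exact: measurable_thick.
exists (D `&` thick A); split.
- by apply: measurableI => //; exact: measurable_thick.
- apply: thick_thin => //; apply: (@thin_exists J _ (fun j => above (B j) (~` thick (B j)))).
    by move=> j; exact: thin_thick.
  by move=> z [/AB[j [Pj Bj]] Dz]; exists j; split=> //; exact: Dz.
- move=> x /= /not_implyP[Ax nB]; split=> // j Pj tB.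
  by apply: nB; exists j.
Qed.

Lemma ae_thick_base (A : set (X * Y)) (D : set X) : measurable D ->
  (forall z, A z -> D z.1) -> \forall x \ae mu, thick A x -> D x.
Proof.
move=> mD AD; exists (~` D `&` thick A); split.
- by apply: measurableI; [exact: measurableC|exact: measurable_thick].
- apply: thick_thin; first exact: measurableC.
  by apply: thinS thin0 => z [/AD].
- by move=> x /= /not_implyP[? ?].
Qed.

End thin_ideal.

Context (I : countType).
Local Notation Y := (bits I).

(** If at [x] no coordinate splits [A] into two thick halves, the coordinates
    with a thick upper half define a point [f x], measurably in [x]; all the
    halves that avoid [f x] are thin, and what remains of [A] is in the graph of
    [f]. *)
Lemma ae_thick_split (A : set (X * Y)) : \forall x \ae mu, thick A x ->
  exists i, thick [set z | A z /\ z.2 i] x /\ thick [set z | A z /\ ~ z.2 i] x.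
Proof.
pose T i := thick [set z | A z /\ z.2 i].
pose U i := thick [set z | A z /\ ~ z.2 i].
pose E := [set x | forall i, ~ (T i `&` U i) x].
have mE : measurable E.
  apply: measurable_forall => i; apply: measurableC.
  by apply: measurableI; exact: measurable_thick.
pose f x : Y := fun i => `[< T i x >].
have mf : measurable_fun setT f.
  apply: measurable_fun_bits => i; rewrite (_ : mkset _ = T i); first exact: measurable_thick.
  by apply/seteqP; split=> x; [move/asboolP|move=> ?; exact/asboolP].
exists (E `&` thick A); split.
- by apply: measurableI => //; exact: measurable_thick.
- apply: thick_thin => //.
  pose B (j : option (I + I)) : set (X * Y) := match j with
    | None => [set z | z.2 = f z.1]
    | Some (inl i) => above [set z | A z /\ z.2 i] (~` T i)
    | Some (inr i) => above [set z | A z /\ ~ z.2 i] (~` U i) end.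
  apply: (@thin_exists _ _ _ _ B).
    move=> [[i|i]|] /=; [exact: thin_thick|exact: thin_thick|exact: thin_graph mf _].
  move=> [x y] [/= Axy Ex].
  have [yE|] := pselect (y = f x); first by exists None.
  move=> yf; have [i yi] : exists i, y i <> f x i.
    by apply/existsNP => h; apply: yf; exact/funext.
  have [Tx|nTx] := pselect (T i x).
    exists (Some (inr i)); split=> /=; last by move=> Ux; exact: (Ex i).
    by split=> // yi1; apply: yi; rewrite yi1 /f asboolT.
  exists (Some (inl i)); split=> //=; split=> //.
  by apply: contrapT => /negP/negbTE yi1; apply: yi; rewrite yi1 /f asboolF.
- move=> x /= /not_implyP[Ax nE]; split=> // i [h1 h2].
  by apply: nE; exists i.
Qed.

End thin.

(** * Uniformization of Borel sets with countable sections *)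

Section borel_codes.
Context d (X : measurableType d) (I : countType).

(** A Borel set together with a way to build it.  Only the countably many sets
    that appear in the construction of a given set matter in the argument below,
    and its last step is an induction on the construction. *)
Inductive code : Type :=
| CBase (D : set X) of measurable D
| CCyl of I
| CNot of code
| CUnion of nat -> code.

Fixpoint interp (c : code) : set (X * bits I) :=
  match c with
  | CBase D _ => [set z : X * bits I | D z.1]
  | CCyl i => [set z : X * bits I | z.2 i]
  | CNot c' => ~` interp c'
  | CUnion F => \bigcup_n interp (F n)
  end.

Fixpoint subcodes (c : code) : set code :=
  match c with
  | CNot c' => c |` subcodes c'
  | CUnion F => c |` \bigcup_n subcodes (F n)
  | _ => [set c]
  end.

Lemma subcodes_refl c : subcodes c c.
Proof. by case: c => * //=; left. Qed.

Lemma countable_subcodes c : countable (subcodes c).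
Proof.
elim: c => [D mD|i|c IHc|F IHF] /=; try exact: countable1.
  by apply: countable_setU => //; exact: countable1.
by apply: countable_setU; [exact: countable1|exact: bigcup_countable].
Qed.

Lemma subcodes_not c c' : subcodes c (CNot c') -> subcodes c c'.
Proof.
elim: c => [D mD|i|c IHc|F IHF] //=.
  by move=> [[->]|/IHc]; right => //; exact: subcodes_refl.
by move=> [//|[n _ /IHF h]]; right; exists n.
Qed.

Lemma subcodes_union c F n : subcodes c (CUnion F) -> subcodes c (F n).
Proof.
elim: c => [D mD|i|c IHc|G IHG] //=.
  by move=> [//|/IHc]; right.
move=> [[->]|[m _ /IHG h]]; right; last by exists m.
by exists n => //; exact: subcodes_refl.
Qed.

Lemma sigma_algebra_interp (T : Type) (f : X * bits I -> T) :
  sigma_algebra setT [set A | exists c, interp c = f @^-1` A].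
Proof.
split=> /=.
- by exists (CBase measurable0) => /=; apply/seteqP; split.
- by move=> A [c cA]; exists (CNot c) => /=; rewrite cA setTD.
- move=> F /choice[c cF]; exists (CUnion c) => /=.
  by rewrite preimage_bigcup; apply: eq_bigcupr => n _.
Qed.

Lemma measurable_code (A : set (X * bits I)) : measurable A ->
  exists c, interp c = A.
Proof.
have snd_code : forall B : set (bits I), measurable B ->
    exists c, interp c = snd @^-1` B.
  apply: smallest_sub; first exact: sigma_algebra_interp.
  by move=> _ [i _ <-]; exists (CCyl i).
move: A; apply: (@smallest_sub _ _ _ [set A | exists c, interp c = A]).
  exact: (sigma_algebra_interp idfun).
move=> A [[D mD <-]|[B mB <-]]; rewrite setTI; last exact: snd_code.
by exists (CBase mD).
Qed.

End borel_codes.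
Arguments CCyl {d X I}.

Section countable_sections.
Context (R : realType) d (X : measurableType d) (mu : probability X R) (I : countType).
Local Notation code := (code X I).
Local Notation Y := (bits I).
Local Notation thick := (thick mu).

Section generic_point.
Variables (c0 : code) (e : nat -> code) (n0 : nat).
Hypothesis e0 : e n0 = c0.
Hypothesis e_sub : forall n, (subcodes c0 `|` range CCyl) (e n).
Hypothesis e_surj : forall c, (subcodes c0 `|` range CCyl) c -> exists n, e n = c.

Let e_cyl i : exists n, e n = CCyl i.
Proof. by apply: e_surj; right; exists i. Qed.

Let e_not n c : e n = CNot c -> exists m, e m = c.
Proof.
move=> en; apply: e_surj; left; apply: subcodes_not; rewrite -en.
by have [//|[i _ ei]] := e_sub n; rewrite en in ei.
Qed.

Let e_union n F j : e n = CUnion F -> exists m, e m = F j.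
Proof.
move=> en; apply: e_surj; left; apply: subcodes_union; rewrite -en.
by have [//|[i _ ei]] := e_sub n; rewrite en in ei.
Qed.

(** The set of points satisfying a finite list of decisions, the pair [(n, b)]
    standing for membership or not in the set coded by [e n]. *)
Definition cond (l : seq (nat * bool)) : set (X * Y) :=
  [set z | forall p, p \in l -> interp (e p.1) z <-> p.2].

(** What almost every point of the base satisfies: a condition that is thick at
    [x] is consistent and its decisions about the base are correct for [x]; and
    it has thick extensions that decide a given set, that choose a member of a
    union already decided to hold, and that decide some coordinate either way. *)
Definition generic_base (x : X) : Prop :=
  [/\ forall l n, thick (cond l) x -> exists b, thick (cond ((n, b) :: l)) x,
      forall l, thick (cond l) x -> cond l !=set0,
      forall l n F, e n = CUnion F -> (n, true) \in l -> thick (cond l) x ->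
        exists m, (exists j, e m = F j) /\ thick (cond ((m, true) :: l)) x,
      forall l n b D mD, e n = @CBase _ _ _ D mD -> (n, b) \in l ->
        thick (cond l) x -> D x <-> b
    & forall l, thick (cond l) x -> exists i, forall m, e m = CCyl i ->
        forall b, thick (cond ((m, b) :: l)) x].

Let condE l n b : cond ((n, b) :: l) = [set z | cond l z /\ (interp (e n) z <-> b)].
Proof.
apply/seteqP; split=> [z h|z [h1 h2] p].
  split; last by apply: (h (n, b)); rewrite inE eqxx.
  by move=> p pl; apply: h; rewrite inE pl orbT.
by rewrite inE => /predU1P[->//|]; exact: h1.
Qed.

Lemma ae_generic_base : \forall x \ae mu, generic_base x.
Proof.
have h1 : \forall x \ae mu, forall l n, thick (cond l) x -> exists b, thick (cond ((n, b) :: l)) x.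
  apply: ae_forall_countType => l; apply: ae_forall_countType => n.
  have := @ae_thick_cover _ _ _ mu _ Y bool (fun=> True) (cond l) (fun b => cond ((n, b) :: l)).
  move=> /(_ _)/filterS; apply; first by move=> x h /h[b [_ hb]]; exists b.
  move=> z lz; exists `[< interp (e n) z >]; split=> //; rewrite condE; split=> //.
  by split=> [?|/asboolP//]; exact/asboolP.
have h2 : \forall x \ae mu, forall l, thick (cond l) x -> cond l !=set0.
  apply: ae_forall_countType => l.
  have [l0|nl0] := pselect (cond l !=set0); first exact: aeW.
  have := @ae_thick_cover _ _ _ mu _ Y void (fun=> True) (cond l) (fun=> set0).
  move=> /(_ _)/filterS; apply; first by move=> x h /h[[]].
  by move=> z lz; exfalso; apply: nl0; exists z.
have h3 : \forall x \ae mu, forall l n F, e n = CUnion F -> (n, true) \in l -> thick (cond l) x ->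
        exists m, (exists j, e m = F j) /\ thick (cond ((m, true) :: l)) x.
  apply: ae_forall_countType => l; apply: ae_forall_countType => n.
  have [[F en]|nF] := pselect (exists F, e n = CUnion F); last first.
    by apply: aeW => x F en; exfalso; apply: nF; exists F.
  have [nl|nl] := boolP ((n, true) \in l); last exact: aeW.
  have := @ae_thick_cover _ _ _ mu _ Y nat (fun m => exists j, e m = F j) (cond l) (fun m => cond ((m, true) :: l)).
  move=> /(_ _)/filterS; apply.
    by move=> x h G; rewrite en => -[<-] _ /h.
  move=> z lz; have := (lz _ nl).2 isT; rewrite /= en => -[j _ Fjz].
  have [m em] := e_union j en.
  by exists m; split; [exists j|rewrite condE; split=> //; rewrite em].
have h4 : \forall x \ae mu, forall l n b D mD, e n = @CBase _ _ _ D mD -> (n, b) \in l ->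
        thick (cond l) x -> D x <-> b.
  apply: ae_forall_countType => l; apply: ae_forall_countType => n; apply: ae_forall_countType => b.
  have [nl|nl] := boolP ((n, b) \in l); last exact: aeW.
  have [[D [mD en]]|nF] := pselect (exists D mD, e n = @CBase _ _ _ D mD); last first.
    by apply: aeW => x D mD en; exfalso; apply: nF; exists D, mD.
  have := @ae_thick_base _ _ _ mu _ Y (cond l) (if b then D else ~` D).
  move=> /(_ _ _)/filterS; apply.
  - move=> x h D' mD'; rewrite en => -[DD'] _ /h; rewrite -{}DD'.
    by case: (b); split.
  - by case: (b) => //; exact: measurableC.
  - move=> z lz; have := lz _ nl; rewrite /= en /=.
    by case: (b) => -[zb bz]; [exact: bz|move=> /zb].
have h5 : \forall x \ae mu, forall l, thick (cond l) x -> exists i, forall m, e m = CCyl i ->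
        forall b, thick (cond ((m, b) :: l)) x.
  apply: ae_forall_countType => l.
  apply: filterS (ae_thick_split mu (cond l)) => x h /h[i [hi1 hi2]].
  exists i => m em [].
    rewrite (_ : cond _ = [set z | cond l z /\ z.2 i]) //.
    by rewrite condE em /=; apply/seteqP; split=> z /= [lz h0]; split=> //; exact: h0.2.
  rewrite (_ : cond _ = [set z | cond l z /\ ~ z.2 i]) //.
  by rewrite condE em /=; apply/seteqP; split=> z /= [lz h0]; split=> // /h0.
by apply: filterS2 (filterI (filterI h1 h2) h3) (filterI h4 h5) => x [[? ?] ?] [? ?]; split.
Qed.

Variable (x : X).
Hypothesis gx : generic_base x.

Let step (z : Y) (l : seq (nat * bool)) (k : nat) : thick (cond l) x ->
  exists l', [/\ {subset l <= l'}, thick (cond l') x, exists b, (k, b) \in l',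
    forall F, e k = CUnion F -> (k, true) \in l' ->
      exists m, (exists j, e m = F j) /\ (m, true) \in l'
  & exists m i, e m = CCyl i /\ (m, ~~ z i) \in l'].
Proof.
have [g1 g2 g3 g4 g5] := gx.
move=> /g5[i]; have [m em] := e_cyl i => /(_ m em (~~ z i)).
set l1 := _ :: l => /(g1 _ k)[b]; set l2 := _ :: l1 => l2x.
have [[F [ek kl2]]|nF] := pselect (exists F, e k = CUnion F /\ (k, true) \in l2).
  have [m' [[j em'] l3x]] := g3 _ _ _ ek kl2 l2x.
  exists ((m', true) :: l2); split=> //.
  - by move=> p pl; rewrite !inE pl !orbT.
  - by exists b; rewrite !inE eqxx !orbT.
  - move=> F'; rewrite ek => -[<-] _; exists m'; split; first by exists j.
    by rewrite inE eqxx.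
  - by exists m, i; split=> //; rewrite !inE eqxx !orbT.
exists l2; split=> //.
- by move=> p pl; rewrite !inE pl !orbT.
- by exists b; rewrite !inE eqxx.
- by move=> F ek kl2; exfalso; apply: nF; exists F.
- by exists m, i; split=> //; rewrite !inE eqxx !orbT.
Qed.

(** Rasiowa-Sikorski: countably many requirements are met along a chain of
    conditions thick at [x].  Deciding every set and choosing members of unions
    makes the bits decided along the chain a point of the section; deciding a
    coordinate against [z k] at stage [k] keeps this point away from [z k]. *)
Lemma generic_point (z : nat -> Y) : thick (interp c0) x ->
  exists2 y, interp c0 (x, y) & forall k, y <> z k.
Proof.
move=> c0x; have [g1 g2 g3 g4 g5] := gx.
have l0x : thick (cond [:: (n0, true)]) x.
  rewrite (_ : cond _ = interp c0) //; rewrite condE e0.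
  by apply/seteqP; split=> w /= => [[_ ->]|w0].
have stepP (lk : seq (nat * bool) * nat) : exists l', thick (cond lk.1) x ->
    [/\ {subset lk.1 <= l'}, thick (cond l') x, exists b, (lk.2, b) \in l',
    forall F, e lk.2 = CUnion F -> (lk.2, true) \in l' ->
      exists m, (exists j, e m = F j) /\ (m, true) \in l'
  & exists m i, e m = CCyl i /\ (m, ~~ z lk.2 i) \in l'].
  have [lx|nlx] := pselect (thick (cond lk.1) x); last by exists [::].
  by have [l' h] := step (z lk.2) lk.2 lx; exists l'.
have {stepP}[st stP] := choice stepP.
pose L := fix L n := if n is k.+1 then st (L k, k) else [:: (n0, true)].
have Lx n : thick (cond (L n)) x.
  by elim: n => [//|n IHn]; have [] := stP (L n, n) IHn.
have Lmono n m : (n <= m)%N -> {subset L n <= L m}.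
  elim: m => [|m IHm]; first by rewrite leqn0 => /eqP ->.
  rewrite leq_eqVlt => /predU1P[->//|]; rewrite ltnS => /IHm h p /h.
  by have [+ _ _ _ _] := stP (L m, m) (Lx m); apply.
pose dec n b := exists k, (n, b) \in L k.
have dec_tot n : exists b, dec n b.
  by have [_ _ [b nb] _ _] := stP (L n, n) (Lx n); exists b, n.+1.
have dec_sat n b m b' : dec n b -> dec m b' ->
    exists w, (interp (e n) w <-> b) /\ (interp (e m) w <-> b').
  move=> [k nk] [k' mk]; have [w wP] := g2 _ (Lx (maxn k k')).
  by exists w; split; apply: (wP (_, _)); [apply: Lmono nk; exact: leq_maxl|apply: Lmono mk; exact: leq_maxr].
pose y : Y := fun i => `[< exists m, e m = CCyl i /\ dec m true >].
have dec_uniq n m b b' : e n = e m -> dec n b -> dec m b' -> b = b'.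
  move=> nm dn dm; have [w [h1 h2]] := dec_sat _ _ _ _ dn dm.
  by apply/idP/idP => [/h1|/h2]; rewrite ?nm => h; [exact/h2|rewrite -nm in h; exact/h1].
have decP c n b : e n = c -> dec n b -> interp c (x, y) <-> b.
  elim: c n b => [D mD|i|c IHc|F IHF] n b en dn /=.
  - have [k nk] := dn; exact: (g4 _ _ _ _ _ en nk (Lx k)).
  - split=> [/asboolP[m [em dm]]|bT]; last by apply/asboolP; exists n; rewrite bT in dn.
    by rewrite (dec_uniq n m b true)// en em.
  - have [m em] := e_not en; have [b' dm] := dec_tot m.
    have := IHc _ _ em dm; have [w [h1 h2]] := dec_sat _ _ _ _ dn dm.
    rewrite en em /= in h1 h2; move: h1 h2.
    by case: (b) => -[h1 h2]; case: (b') => -[h3 h4] [h5 h6]; split=> //; try tauto; move=> _; tauto.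
  - split=> [[j _ Fj]|bT].
      have [m em] := e_union j en; have [b' dm] := dec_tot m.
      have [w [h1 h2]] := dec_sat _ _ _ _ dn dm.
      rewrite en em /= in h1 h2; apply/h1; exists j => //; apply/h2.
      exact/(IHF _ _ _ em dm).
    rewrite bT in dn; have [_ _ _ h _] := stP (L n, n) (Lx n).
    have [_ _ [b' nb'] _ _] := stP (L n, n) (Lx n).
    have b'T : b' = true by apply: (dec_uniq n n) => //; exists n.+1.
    rewrite b'T in nb'; have [m [[j em] mL]] := h _ en nb'.
    exists j => //; apply/(IHF _ _ true em) => //.
    by exists n.+1.
exists y; first by apply/(decP _ n0 true e0) => //; exists 0%N; rewrite inE eqxx.
move=> k yz; have [_ _ _ _ [m [i [em mL]]]] := stP (L k, k) (Lx k).
have dm : dec m (~~ z k i) by exists k.+1.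
have := decP _ _ _ em dm; rewrite /= yz.
by case: (z k i) => -[h1 h2]; [have := h1 isT|have := h2 isT].
Qed.

End generic_point.

(** Lusin-Novikov uniformization, up to a null set: over almost every point
    where [A] is thick, no countable set exhausts the section of [A]. *)
Theorem thin_countable_sections (A : set (X * Y)) : measurable A ->
  (forall x, countable [set y | A (x, y)]) -> thin mu A.
Proof.
move=> mA cA; have [c cE] := measurable_code mA.
have cE' : countable (subcodes c `|` range CCyl).
  apply: countable_setU; first exact: countable_subcodes.
  by apply: countable_image; exact: countableP.
have [e e_sub e_surj] := @countable_enum _ _ c (or_introl (subcodes_refl c)) cE'.
have [n0 en0] := e_surj c (or_introl (subcodes_refl c)).
have nA : mu.-negligible (thick A).
  have [N [mN N0 sN]] := ae_generic_base e_sub e_surj.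
  exists N; split=> // x Ax; apply: sN => gx.
  have [[y0 Ay0]|nA] := pselect ([set y | A (x, y)] !=set0); last first.
    have := generic_point en0 e_sub e_surj gx (fun=> point).
    by rewrite cE => /(_ Ax)[y Ay _]; apply: nA; exists y.
  have [z zA Az] := countable_enum Ay0 (cA x).
  have := generic_point en0 e_sub e_surj gx z; rewrite cE => /(_ Ax)[y Ay yz].
  by have [k zk] := Az _ Ay; exact: (yz k).
refine (@thin_exists _ _ _ mu _ Y bool A (fun b : bool => if b then above A (~` thick A) else [set z : X * Y | thick A z.1]) _ _).
  by move=> [|]; [exact: thin_thick|exact: thin_negligible nA _].
by move=> z Az; have [|] := pselect (thick A z.1); [exists false|exists true].
Qed.

End countable_sections.

(** * Integrals of counting functions *)

Section counting_integral.
Context (R : realType) d (X : measurableType d) (mu : probability X R).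
Context (G : choiceType) (f : G -> X).
Local Open Scope ereal_scope.
Import HBNNSimple.

Lemma counting_ge0 (A : set G) : 0 <= counting A :> \bar R.
Proof. by rewrite /counting; case: ifPn; rewrite ?lee_fin// leey. Qed.

Lemma counting_ge1 (A : set G) : A !=set0 -> 1 <= counting A :> \bar R.
Proof.
move=> [a Aa]; rewrite /counting; case: asboolP => fA; last exact: leey.
rewrite lee_fin ler1n lt0n finmap.cardfs_eq0; apply/eqP => A0.
by have := fset_set_set0 fA A0; move: Aa => /[swap] ->.
Qed.

Let cnt (A : set G) (x : X) : \bar R := counting (A `&` f @^-1` [set x]).

(** The number of points in a fibre may fail to be a measurable function; its
    integral is then a lower integral.  Being at least 1 on the image of [A], it
    has integral 0 exactly when this image has no measurable subset of positive
    measure. *)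
Lemma integral_counting_eq0P (A : set G) :
  \int[mu]_x counting (A `&` f @^-1` [set x]) = 0 <-> mu.-null_set (f @` A).
Proof.
rewrite ge0_integralTE => [|x]; last exact: counting_ge0.
split=> [int0 D mD Df|nA].
  apply/eqP; rewrite eq_le measure_ge0 andbT -int0 -(sintegral_indic mu D).
  apply: ereal_sup_ubound; exists (indic_nnsfun R mD) => //= x.
  rewrite mindicE; case: (boolP (x \in D)) => [/set_mem/Df[a Aa ax]|_]; last exact: counting_ge0.
  by apply: counting_ge1; exists a.
apply/eqP; rewrite eq_le; apply/andP; split; last first.
  by apply: ereal_sup_ubound; exists nnsfun0 => [x|]; [exact: counting_ge0|exact: sintegral0].
apply: ge_ereal_sup => _ [h hf <-].
rewrite sintegralE fsbig1// => r _; have [<-|r0] := eqVneq 0%R r; first by rewrite mul0e.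
have [rneg|rpos] := ltP r 0%R.
  rewrite preimage10 ?measure0 ?mule0// => -[x _ xr].
  by have : (0 <= h x)%R by []; rewrite xr leNgt rneg.
rewrite [X in _ * X](_ : _ = 0) ?mule0//; apply: nA; first exact: measurable_sfunP.
move=> x xr.
have : 0 < cnt A x.
  by rewrite (lt_le_trans _ (hf x))// xr lte_fin lt_neqAle r0.
rewrite /cnt; case: (pselect ((A `&` f @^-1` [set x]) !=set0)) => [[a [Aa ax]]|nA0].
  by move=> _; exists a.
have -> : A `&` f @^-1` [set x] = set0 by apply/seteqP; split=> // a Aa; apply: nA0; exists a.
by rewrite /counting asboolT// fset_set0 finmap.cardfs0 ltxx.
Qed.

Lemma integral_counting_infinite (A : set G) (D : set X) : measurable D -> mu D != 0 ->
  (forall x, D x -> infinite_set (A `&` f @^-1` [set x])) ->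
  \int[mu]_x counting (A `&` f @^-1` [set x]) = +oo.
Proof.
move=> mD D0 infA; rewrite ge0_integralTE => [|x]; last exact: counting_ge0.
have Dfin : mu D \is a fin_num by exact: fin_num_measure.
have Dpos : (0 < fine (mu D))%R by rewrite fine_gt0// lt_neqAle eq_sym D0 measure_ge0 ltey_eq Dfin.
set N := (X in X = _).
have h k : (k%:R * fine (mu D))%:E <= N.
  rewrite EFinM fineK//.
  have -> : mu D = sintegral mu (indic_nnsfun R mD) by rewrite sintegral_indic.
  rewrite -sintegralrM /N.
  apply: ereal_sup_ubound; exists (scale_nnsfun (indic_nnsfun R mD) (ler0n R k)) => // x /=.
  rewrite mindicE; case: (boolP (x \in D)) => [/set_mem/infA infx|_]; last by rewrite mulr0 counting_ge0.
  by rewrite /cnt /counting asboolF// leey.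
apply/eqyP => r r0.
have [k rk] : exists k : nat, (r / fine (mu D) <= k%:R)%R.
  by exists (Num.Def.archi_bound (r / fine (mu D))); apply/ltW/unstable.ltr_bound.
by apply: le_trans (h k); rewrite lee_fin -ler_pdivrMr.
Qed.

End counting_integral.

Lemma mu_src_eq0P (R : realType) d (X : measurableType d) (mu : probability X R)
    d' (G : measurableType d') (g : groupoid X G) (A : set G) :
  mu_src mu g A = 0%E <-> mu.-null_set (gsrc g @` A).
Proof. exact: integral_counting_eq0P. Qed.

Lemma mu_tgt_eq0P (R : realType) d (X : measurableType d) (mu : probability X R)
    d' (G : measurableType d') (g : groupoid X G) (A : set G) :
  mu_tgt mu g A = 0%E <-> mu.-null_set (gtgt g @` A).
Proof. exact: integral_counting_eq0P. Qed.

(** * Enumeration of the orbits *)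

Section coded_facts.
Context d (X : measurableType d).
Hypothesis cX : cantor_coded X.

Lemma measurable_eq_fun d' (T : measurableType d') (f g : T -> X) :
  measurable_fun setT f -> measurable_fun setT g -> measurable [set t | f t = g t].
Proof.
move=> mf mg; have [I [c [ic mc _ _]]] := cX.
rewrite (_ : mkset _ = [set t | forall i, (c (f t) i -> c (g t) i) /\ (c (g t) i -> c (f t) i)]).
  have mci h i : measurable_fun setT h -> measurable [set t : T | c (h t) i].
    move=> mh; apply: (@measurable_pre _ _ _ _ (c \o h) [set b | b i]).
      exact: measurableT_comp.
    exact: measurable_cylinder.
  apply: measurable_forall => i; apply: measurableI.
    by apply: (@measurable_imply _ _ [set t | c (f t) i] [set t | c (g t) i]); exact: mci.
  by apply: (@measurable_imply _ _ [set t | c (g t) i] [set t | c (f t) i]); exact: mci.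
apply/seteqP; split=> t /=; first by move=> -> i; split.
by move=> h; apply: ic; apply/funext => i; have [? ?] := h i; exact/idP/idP.
Qed.

Lemma measurable_point (x : X) : measurable [set x].
Proof.
by apply: (@measurable_eq_fun _ X idfun (cst x)); [exact: measurable_id|exact: measurable_cst].
Qed.

Lemma measurable_countable (A : set X) : countable A -> measurable A.
Proof.
exact: countable_measurable measurable_point.
Qed.

Lemma cantor_code_retract (I : countType) (c : X -> bits I) :
  injective c -> measurable_fun setT c -> measurable (range c) ->
  (forall A : set X, measurable A -> exists2 B : set (bits I), measurable B & A = c @^-1` B) ->
  exists2 r : bits I -> X, measurable_fun setT r & cancel c r.
Proof.
move=> ic mc rc sc.
have rP b : exists x, (range c b -> c x = b) /\ (~ range c b -> x = point).
  have [[x _ xb]|nb] := pselect (range c b); first by exists x; split=> // h; exfalso; apply: h; exists x.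
  by exists point.
have [r {}rP] := choice rP.
exists r; last by move=> x; apply: ic; apply: (rP (c x)).1; exists x.
move=> _ A mA; rewrite setTI.
rewrite (_ : _ @^-1` _ = c @` A `|` (~` range c `&` [set _ | A point])).
  apply: measurableU; first exact: cantor_coded_image ic rc (sc _ mA).
  by apply: measurableI; [exact: measurableC|exact: measurable_const].
apply/seteqP; split=> b /=.
  move=> Ar; have [rb|nb] := pselect (range c b).
    by left; exists (r b) => //; apply: (rP b).1.
  by right; split=> //; rewrite -((rP b).2 nb).
move=> [[x Ax <-]|[nb Ap]]; last by rewrite ((rP b).2 nb).
suff -> : r (c x) = x by [].
by apply: ic; apply: (rP (c x)).1; exists x.
Qed.

End coded_facts.

Section conull_sets.
Context (R : realType) d (X : measurableType d) (mu : probability X R).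

Lemma conullI (A B : set X) : conull mu A -> conull mu B -> conull mu (A `&` B).
Proof.
move=> [mA A0] [mB B0]; split; first exact: measurableI.
by rewrite setCI measureU0//; exact: measurableC.
Qed.

Lemma countable_conull_atom (A : set X) : cantor_coded X -> conull mu A ->
  countable A -> exists2 y, A y & mu [set y] != 0%E.
Proof.
move=> cX [mA A0] cA; apply: contrapT => h.
have n0 y : A y -> mu.-negligible [set y].
  move=> Ay; exists [set y]; split=> //; first exact: measurable_point.
  by apply/eqP/negPn/negP => ne; apply: h; exists y.
have nA : mu.-negligible A.
  have [[y0 Ay0]|nA] := pselect (exists y, A y); last first.
    have -> : A = set0 by apply/seteqP; split=> // y Ay; apply: nA; exists y.
    exact: negligible_set0.
  have [q qA Aq] := countable_enum Ay0 cA.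
  apply: (@negligibleS _ _ _ _ (\bigcup_n [set q n])).
    by move=> y /Aq[n <-]; exists n.
  by apply: negligible_bigcup => n; exact: n0.
have nT : mu.-negligible [set: X].
  apply: (@negligibleS _ _ _ _ (A `|` ~` A)); first by rewrite setUv.
  apply: negligibleU => //; exists (~` A); split=> //; exact: measurableC.
have : mu [set: X] = 0%E by exact: measure_negligible.
by rewrite probability_setT => /eqP; rewrite onee_eq0.
Qed.

End conull_sets.

Section orbits.
Context (R : realType) d (X : measurableType d) (mu : probability X R) (S : eqv_rel X).
Hypothesis cX : cantor_coded X.

Lemma rel_nonsingular : nonsingular mu (eqv_rel_groupoid S) ->
  forall B : set (X * X), measurable B -> B `<=` rel_of S ->
    mu.-null_set (snd @` B) <-> mu.-null_set (fst @` B).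
Proof.
move=> nsS B mB BS.
pose A : set (eqv_rel_space S) := [set p | B (\val p)].
have mA : measurable A by exists B => //; rewrite setTI.
have := nsS A mA; rewrite mu_src_eq0P mu_tgt_eq0P.
have im (h : X * X -> X) : (fun p : eqv_rel_space S => h (\val p)) @` A = h @` B.
  apply/seteqP; split=> [_ [p Bp <-]|_ [p Bp <-]]; first by exists (\val p).
  by exists (exist _ p (mem_set (BS p Bp))).
by rewrite -(im snd) -(im fst).
Qed.

Hypothesis hS : countable_measured_eqv_rel mu S.

Lemma orbit_enum_ae : exists f : nat -> X -> X,
  [/\ forall n, measurable_fun setT (f n), forall n x, rel_of S (x, f n x)
    & \forall x \ae mu, forall y, rel_of S (x, y) -> exists n, y = f n x].
Proof.
have [mS cS _] := hS; have [I [c [ic mc rc sc]]] := cX.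
have [r mr cr] := cantor_code_retract ic mc rc sc.
pose A : set (X * bits I) := [set z | rel_of S (z.1, r z.2) /\ range c z.2].
have mA : measurable A.
  apply: measurableI; last exact: (@measurable_pre _ _ _ _ snd).
  apply: (@measurable_pre _ _ _ _ (fun z : X * bits I => (z.1, r z.2)) (rel_of S)) => //.
  by apply: measurable_fun_pair => //; apply: measurableT_comp.
have cA x : countable [set y | A (x, y)].
  apply: (@sub_countable _ _ _ (c @` [set y | rel_of S (x, y)])); last exact: countable_image.
  apply: subset_card_le => b [/= Sxb [y _ yb]]; exists y => //=.
  by rewrite -yb cr in Sxb.
have [F [cF mF nF]] := thin_countable_sections mu mA cA.
have [q qF Fq] := @countable_enum _ (F `|` [set cst point]) _ (or_intror erefl)
  (countable_setU cF (countable1 _)).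
have mq n : measurable_fun setT (q n).
  by have [/mF//|->] := qF n; exact: measurable_cst.
pose f n x := if `[< rel_of S (x, r (q n x)) >] then r (q n x) else x.
exists f; split.
- move=> n; apply: measurable_fun_ifT => //; last by apply: measurableT_comp.
  apply: (measurable_fun_bool true); rewrite setTI.
  rewrite (_ : _ @^-1` _ = (fun x => (x, r (q n x))) @^-1` rel_of S).
    apply: measurable_pre => //; apply: measurable_fun_pair => //.
    by apply: measurableT_comp.
  by apply/seteqP; split=> x; [move/asboolP|move=> ?; exact/asboolP].
- by move=> n x; rewrite /f; case: asboolP => // _; exact: eqv_rel_refl.
- apply: negligibleS nF => x /= /existsNP[y /not_implyP[Sxy nf]].
  exists (c y); split; first by split=> /=; [rewrite cr|exists y].
  move=> h Fh cyh; apply: nf; have [n qn] := Fq h (or_introl Fh).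
  have rE : r (q n x) = y by rewrite qn -cyh cr.
  by exists n; rewrite /f rE asboolT.
Qed.

(** The points whose orbit meets the exceptional null set are removed; they
    form a null set since the relation is non-singular. *)
Lemma orbit_enum : exists (f : nat -> X -> X) (X0 : set X),
  [/\ forall n, measurable_fun setT (f n), forall n x, rel_of S (x, f n x),
      conull mu X0, forall x y, X0 x -> rel_of S (x, y) -> exists n, y = f n x
    & forall x y, X0 x -> rel_of S (x, y) -> X0 y].
Proof.
have [f [mf Sf [N [mN N0 fN]]]] := orbit_enum_ae.
have [mS cS nsS] := hS.
have enum x y : ~ N x -> rel_of S (x, y) -> exists n, y = f n x.
  by move=> nNx; apply: contrapT => h; apply: nNx; apply: fN => h'; apply: h; exact: h'.
pose X0 := [set x | ~ N x /\ forall n, ~ N (f n x)].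
have mfN n : measurable (f n @^-1` N) by exact: measurable_pre.
have fN0 n : mu (f n @^-1` N) = 0%E.
  pose B := [set z : X * X | z.2 = f n z.1] `&` snd @^-1` N.
  have mB : measurable B.
    apply: measurableI; last exact: (@measurable_pre _ _ _ _ snd).
    by apply: (measurable_eq_fun cX); [exact: measurable_snd|exact: (measurableT_comp (mf n) measurable_fst)].
  have BS : B `<=` rel_of S by move=> [x y] [/= -> _]; exact: Sf.
  have [h _] := rel_nonsingular nsS mB BS.
  apply: (h _ (f n @^-1` N)) => //.
    move=> D mD DN; apply: (@subset_measure0 _ _ _ mu D N) => //.
    by move=> y /DN[z [_ Nz] <-].
  by move=> x Nfx; exists (x, f n x).
exists f, X0; split=> //.
- have mX0 : measurable X0.
    apply: measurableI; first exact: measurableC.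
    by apply: measurable_forall => n; exact: (measurableC (mfN n)).
  split=> //; apply/negligibleP; first exact: measurableC.
  apply: (@negligibleS _ _ _ _ (N `|` \bigcup_n f n @^-1` N)).
    move=> x /not_andP[/contrapT|/existsNP[n /contrapT]]; first by left.
    by right; exists n.
  apply: negligibleU; first by exists N; split.
  by apply: negligible_bigcup => n; exists (f n @^-1` N); split; [exact: mfN|exact: fN0|].
- by move=> x y [/enum + _]; apply.
- move=> x y [nNx nNf] Sxy; split; first by have [n ->] := enum _ _ nNx Sxy.
  move=> n; have [m ->] : exists m, f n y = f m x; last exact: nNf.
  by apply: enum => //; exact: eqv_rel_trans Sxy (Sf n y).
Qed.

End orbits.

(** * Permutations that code a sequence of bits *)

Section permutations.

Definition site : countType := (int * nat)%type.

Definition step_right (p : site) : site := (p.1 + 1, p.2).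
Definition step_left (p : site) : site := (p.1 - 1, p.2).

Definition transp (j k p : site) : site :=
  if p == j then k else if p == k then j else p.

(** The bit [t n] decides whether the first two points of the fibre over [n]
    are exchanged. *)
Definition toggle (t : nat -> bool) (p : site) : site :=
  if p.1 is Posz n then if t n then transp (p.1, 0%N) (p.1, 1%N) p else p else p.

Lemma step_rightK : cancel step_right step_left.
Proof. by case=> i e; rewrite /step_right /step_left /= addrK. Qed.

Lemma step_leftK : cancel step_left step_right.
Proof. by case=> i e; rewrite /step_right /step_left /= subrK. Qed.

Lemma transpK j k : involutive (transp j k).
Proof.
move=> p; rewrite /transp; have [->|pj] := eqVneq p j.
  by rewrite eqxx; case: eqP.
by have [->|/negbTE pk] := eqVneq p k; rewrite ?eqxx// (negbTE pj) pk.
Qed.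

Lemma toggleK t : involutive (toggle t).
Proof.
case=> -[n|n] e //; rewrite /toggle /=; case tn: (t n) => /=; last by rewrite tn.
have -> : (transp (Posz n, 0) (Posz n, 1) (Posz n, e)).1 = Posz n.
  by rewrite /transp; case: ifP => // _; case: ifP.
by rewrite tn transpK.
Qed.

Lemma iter_step_right m p : iter m step_right p = (p.1 + m%:Z, p.2).
Proof.
elim: m => [|m IHm]; first by rewrite addr0 -surjective_pairing.
by rewrite iterS IHm /step_right /=; congr pair; lia.
Qed.

Lemma iter_step_left m p : iter m step_left p = (p.1 - m%:Z, p.2).
Proof.
elim: m => [|m IHm]; first by rewrite subr0 -surjective_pairing.
by rewrite iterS IHm /step_left /=; congr pair; lia.
Qed.

Lemma toggle_fst t p : (toggle t p).1 = p.1.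
Proof.
case: p => -[n|n] e //; rewrite /toggle /=; case: (t n) => //.
by rewrite /transp; case: ifP => // _; case: ifP.
Qed.

Definition probe : site -> site := transp (0, 1%N) (0, 2%N).

Lemma probe_fst p : (probe p).1 = p.1.
Proof. by rewrite /probe /transp; case: eqP => [->//|_]; case: eqP => [->|]. Qed.

Lemma probe_id p : p.1 != 0 -> probe p = p.
Proof.
case: p => i e /= i0; rewrite /probe /transp.
by case: eqP => [[i0']|_]; [|case: eqP => [[i0']|//]]; rewrite i0' in i0.
Qed.

Definition far_toggle (t : nat -> bool) m : site -> site :=
  iter m step_left \o (toggle t \o iter m step_right).

(** The bits of [t] are visible in the group generated by the shift, the
    toggle of [t] and one transposition: the conjugate of the toggle that
    brings fibre [m] over [0] commutes with a transposition of that fibre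
    exactly when it is trivial there. *)
Lemma far_toggle_commute (t : nat -> bool) m :
  far_toggle t m \o probe = probe \o far_toggle t m <-> ~~ t m.
Proof.
have tog p : far_toggle t m p =
    (p.1, (toggle t (p.1 + m%:Z, p.2)).2).
  rewrite /far_toggle /= iter_step_right iter_step_left; congr pair.
  by rewrite toggle_fst /= addrK.
split=> [/(congr1 (@^~ (0, 1%N)))|/negbTE tm].
  rewrite /= !tog /= add0r /toggle /=.
  by case: (t m) => //=; rewrite /transp !xpair_eqE !eqxx /= /probe /transp => -[].
have tog0 p : p.1 = 0 -> far_toggle t m p = p.
  by case: p => i e /= ->; rewrite tog /= add0r /toggle /= tm.
apply/funext => p /=; have [p0|p0] := eqVneq p.1 0.
  by rewrite !tog0 ?probe_fst.
by rewrite (probe_id p0) probe_id // tog.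
Qed.

Lemma transp_l j k : transp j k j = k.
Proof. by rewrite /transp eqxx. Qed.

Lemma transp_id j k p : p != j -> p != k -> transp j k p = p.
Proof. by rewrite /transp => /negbTE -> /negbTE ->. Qed.

Section words.

(** Names for the generators: the shift and its inverse, the transpositions,
    and the toggles of a sequence of points.  Words in these names enumerate the
    group attached to an orbit. *)
Definition letter : countType := (bool + site * site + nat)%type.

Variable t : nat -> nat -> bool.

Definition letter_map (l : letter) : site -> site :=
  match l with
  | inl (inl true) => step_right
  | inl (inl false) => step_left
  | inl (inr (j, k)) => transp j k
  | inr n => toggle (t n)
  end.

Definition letter_inv (l : letter) : letter :=
  match l with
  | inl (inl b) => inl (inl (~~ b))
  | _ => l
  end.

Definition word_map (w : seq letter) : site -> site :=
  foldr (fun l g => letter_map l \o g) idfun w.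

Lemma letter_invK l : letter_map (letter_inv l) \o letter_map l = idfun.
Proof.
apply/funext => p /=; case: l => [[[]|[j k]]|n] /=.
- exact: step_rightK.
- exact: step_leftK.
- exact: transpK.
- exact: toggleK.
Qed.

Lemma letter_invI l : letter_inv (letter_inv l) = l.
Proof. by case: l => [[b|]|] //=; rewrite negbK. Qed.

Lemma word_map_cat w v : word_map (w ++ v) = word_map w \o word_map v.
Proof. by elim: w => //= l w ->. Qed.

Definition word_inv (w : seq letter) := rev (map letter_inv w).

Lemma word_invI w : word_inv (word_inv w) = w.
Proof.
rewrite /word_inv map_rev revK -map_comp -[RHS]map_id.
by apply: eq_map => l /=; rewrite letter_invI.
Qed.

Lemma word_invK w : word_map (word_inv w) \o word_map w = idfun.
Proof.
elim: w => [//|l w IHw]; rewrite /word_inv /= rev_cons -cats1 word_map_cat.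
rewrite -[LHS]/(word_map (word_inv w) \o ((letter_map (letter_inv l) \o letter_map l) \o word_map w)).
by rewrite letter_invK.
Qed.

End words.

End permutations.

(** * The groupoid of an orbit-dependent permutation group *)

Section bundle.
Context (R : realType) d (X : measurableType d) (mu : probability X R) (S : eqv_rel X).
Hypothesis cX : cantor_coded X.
Hypothesis hS : countable_measured_eqv_rel mu S.
Variables (f : nat -> X -> X) (X0 : set X) (V : nat -> set X).
Hypothesis mf : forall n, measurable_fun setT (f n).
Hypothesis Sf : forall n x, rel_of S (x, f n x).
Hypothesis conullX0 : conull mu X0.
Hypothesis enum : forall x y, X0 x -> rel_of S (x, y) -> exists n, y = f n x.
Hypothesis X0_inv : forall x y, X0 x -> rel_of S (x, y) -> X0 y.
Hypothesis mV : forall n, measurable (V n).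

Local Notation P := (fun_space site).

Definition itinerary (x : X) : nat -> bool := fun n => `[< V n x >].

Definition orbit_itineraries (x : X) (n : nat) : nat -> bool := itinerary (f n x).

Definition fibre_word (x : X) (w : seq letter) : P := word_map (orbit_itineraries x) w.

(** The countable group attached to [x], trivial outside [X0].  It only depends
    on the orbit of [x], since the toggles range over all points of the orbit. *)
Definition fibre_group (x : X) : set P :=
  [set g | g = (idfun : site -> site) \/ X0 x /\ exists w, g = fibre_word x w].

Lemma fibre_group1 x : fibre_group x (idfun : site -> site).
Proof. by left. Qed.

Lemma fibre_groupM x (g h : site -> site) : fibre_group x g -> fibre_group x h -> fibre_group x (g \o h).
Proof.
move=> [->//|[X0x [w ->]]] [->|[_ [v ->]]]; right; split=> //; first by exists w.
by exists (w ++ v); rewrite /fibre_word word_map_cat.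
Qed.

Lemma fibre_groupV x (g : site -> site) : fibre_group x g ->
  exists h : site -> site, [/\ fibre_group x h, h \o g = idfun & g \o h = idfun].
Proof.
move=> [->|[X0x [w ->]]]; first by exists idfun; split=> //; exact: fibre_group1.
exists (fibre_word x (word_inv w)); split.
- by right; split=> //; exists (word_inv w).
- exact: word_invK.
- by rewrite -{1}(word_invI w); exact: word_invK.
Qed.

Lemma fibre_group_rel x y (g : site -> site) : rel_of S (x, y) -> fibre_group x g -> fibre_group y g.
Proof.
move=> Sxy [->|[X0x [w ->]]]; first by left.
right; split; first exact: X0_inv Sxy.
rewrite /fibre_word; elim: w => [|l w [v IHw]]; first by exists [::].
have [l' ll'] : exists l', letter_map (orbit_itineraries x) l = letter_map (orbit_itineraries y) l'.
  case: l => [l|n]; first by exists (inl l).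
  have [m fm] := enum (X0_inv X0x Sxy) (eqv_rel_trans (eqv_rel_sym Sxy) (Sf n x)).
  by exists (inr m); rewrite /= /orbit_itineraries fm.
by exists (l' :: v); rewrite /= IHw ll'.
Qed.

(** The inverse of a bijection, as a function of arbitrary maps: its values are
    read off the graph, which makes it measurable in [g]. *)
Definition pinv (g : site -> site) (j : site) : site := xget j [set k | g k = j].

Lemma pinvE (g h : site -> site) : h \o g = idfun -> g \o h = idfun -> pinv g = h.
Proof.
move=> hg gh; apply/funext => j.
have gj : g (pinv g j) = j by apply: (@xgetPex _ j [set k | g k = j]); exists (h j); exact: (congr1 (fun u : site -> site => u j) gh).
by rewrite -[in RHS]gj -[RHS]/((h \o g) _) hg.
Qed.

Lemma fibre_group_pinv x (g : site -> site) : fibre_group x g ->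
  [/\ fibre_group x (pinv g), pinv g \o g = idfun & g \o pinv g = idfun].
Proof. by move=> /fibre_groupV[h [xh hg gh]]; rewrite (pinvE hg gh). Qed.

Definition arrow_set : set (X * X * P) :=
  [set p | rel_of S p.1 /\ fibre_group p.1.1 p.2].

Lemma arrow_set_unit x : arrow_set (x, x, idfun : site -> site).
Proof. by split; [exact: eqv_rel_refl|exact: fibre_group1]. Qed.

Lemma arrow_set_n0 : arrow_set !=set0.
Proof. by exists (point, point, idfun : site -> site); exact: arrow_set_unit. Qed.

Definition arrow := sub_space arrow_set_n0.

Local Notation val_ := (@sub_val _ _ _ arrow_set_n0).

Definition asrc (a : arrow) : X := (val_ a).1.2.
Definition atgt (a : arrow) : X := (val_ a).1.1.
Definition amap (a : arrow) : site -> site := (val_ a).2.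

Lemma arrow_rel a : rel_of S (atgt a, asrc a).
Proof.
have [Sa _] : arrow_set (val_ a) := sub_valP a.
by rewrite /atgt /asrc -surjective_pairing.
Qed.

Lemma arrow_perm a : fibre_group (atgt a) (amap a).
Proof. by have [] : arrow_set (val_ a) := sub_valP a. Qed.

Lemma arrow_eq a b : atgt a = atgt b -> asrc a = asrc b -> amap a = amap b -> a = b.
Proof.
move=> t s p; apply: sub_val_inj; move: t s p; rewrite /atgt /asrc /amap.
by case: (val_ a) => [[? ?] ?]; case: (val_ b) => [[? ?] ?] /= -> -> ->.
Qed.

Definition mk_arrow x y (g : P) (h : arrow_set (x, y, g)) : arrow := to_sub arrow_set_n0 h.

Definition aunit x : arrow := mk_arrow (arrow_set_unit x).

Lemma ainv_subproof a : arrow_set (asrc a, atgt a, pinv (amap a)).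
Proof.
split; first exact: eqv_rel_sym (arrow_rel a).
have [ag _ _] := fibre_group_pinv (arrow_perm a).
exact: fibre_group_rel (arrow_rel a) ag.
Qed.

Definition ainv a : arrow := mk_arrow (ainv_subproof a).

Lemma amul_subproof a b : asrc a = atgt b ->
  arrow_set (atgt a, asrc b, amap a \o amap b).
Proof.
move=> ab; split.
  by apply: eqv_rel_trans (arrow_rel a) _; rewrite ab; exact: arrow_rel.
apply: fibre_groupM; first exact: arrow_perm.
apply: fibre_group_rel (arrow_perm b); rewrite -ab; apply: eqv_rel_sym; exact: arrow_rel.
Qed.

Definition amul a b : arrow :=
  if pselect (asrc a = atgt b) is left ab then mk_arrow (amul_subproof ab) else a.

Lemma amulE a b : asrc a = atgt b ->
  val_ (amul a b) = (atgt a, asrc b, amap a \o amap b : P).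
Proof. by rewrite /amul; case: pselect. Qed.

Lemma tgt_amul a b : asrc a = atgt b -> atgt (amul a b) = atgt a.
Proof. by move=> ab; rewrite {1}/atgt amulE. Qed.

Lemma src_amul a b : asrc a = atgt b -> asrc (amul a b) = asrc b.
Proof. by move=> ab; rewrite {1}/asrc amulE. Qed.

Lemma amap_amul a b : asrc a = atgt b -> amap (amul a b) = amap a \o amap b.
Proof. by move=> ab; rewrite {1}/amap amulE. Qed.

Definition bundle : groupoid X arrow.
Proof.
refine (@Groupoid X arrow asrc atgt aunit ainv amul _ _ _ _ src_amul tgt_amul _ _ _ _ _) => //.
- move=> a b c ab bc; apply: arrow_eq.
  + by rewrite !tgt_amul// src_amul.
  + by rewrite !src_amul ?tgt_amul// src_amul.
  + by rewrite !amap_amul ?tgt_amul// src_amul.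
- by move=> a; apply: arrow_eq; rewrite ?tgt_amul ?src_amul ?amap_amul.
- by move=> a; apply: arrow_eq; rewrite ?tgt_amul ?src_amul ?amap_amul.
- move=> a; apply: arrow_eq; rewrite ?tgt_amul ?src_amul ?amap_amul//.
  by have [_ ? _] := fibre_group_pinv (arrow_perm a).
- move=> a; apply: arrow_eq; rewrite ?tgt_amul ?src_amul ?amap_amul//.
  by have [_ _ ?] := fibre_group_pinv (arrow_perm a).
Defined.

(** * Its Borel structure *)

Lemma measurable_fibre_word w : measurable_fun setT (fibre_word^~ w).
Proof.
apply: measurable_fun_fun_space => j k; rewrite setTI.
elim: w j k => [|l w IHw] j k; first exact: (@measurable_const _ X (j = k)).
rewrite (_ : mkset _ = [set x | exists m : site, fibre_word x w j = m /\
    letter_map (orbit_itineraries x) l m = k]); last first.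
  apply/seteqP; split=> x /=; last by move=> [m [<-]].
  by move=> h; exists (fibre_word x w j).
apply: measurable_exists => m; apply: measurableI; first exact: IHw.
case: l => [l|n]; first exact: (@measurable_const _ X (letter_map (fun _ _ => false) (inl l) m = k)).
have mVn i : measurable [set x | itinerary (f n x) i].
  rewrite (_ : mkset _ = f n @^-1` V i); first exact: measurable_pre.
  by apply/seteqP; split=> x /=; [move/asboolP|move=> ?; exact/asboolP].
rewrite /= /orbit_itineraries /toggle; case: m => -[i|i] e /=; last exact: measurable_const.
rewrite [X in measurable X](_ : _ = [set x | (itinerary (f n x) i -> transp (Posz i, 0%N) (Posz i, 1%N) (Posz i, e) = k) /\
   (~ itinerary (f n x) i -> (Posz i, e) = k)]); last first.
  apply/seteqP; split=> x /=; case: (itinerary (f n x) i) => [h|h].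
  - by split=> // ni; exfalso; exact: ni.
  - by split.
  - by apply: h.1.
  - by apply: h.2.
apply: measurableI; apply: measurable_imply; try exact: measurable_const; first exact: mVn.
exact: (measurableC (mVn i)).
Qed.

Lemma measurable_arrow_set : measurable arrow_set.
Proof.
have [mS _ _] := hS; have [mX0 _] := conullX0.
have mt : measurable_fun setT (fun p : X * X * P => p.1.1).
  by apply: (measurableT_comp measurable_fst); exact: measurable_fst.
have meq (h : X -> P) : measurable_fun setT h -> measurable [set p : X * X * P | p.2 = h p.1.1].
  move=> mh; apply: (measurable_eq_fun (cantor_coded_fun_space site)).
    exact: measurable_snd.
  exact: (measurableT_comp mh mt).
apply: measurableI; first exact: (@measurable_pre _ _ _ _ fst).
apply: measurableU; first by apply: (meq (cst _)); exact: measurable_cst.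
apply: measurableI; first exact: (@measurable_pre _ _ _ _ (fun p : X * X * P => p.1.1)).
apply: (@measurable_exists _ _ (seq letter)) => w; exact: meq (measurable_fibre_word w).
Qed.

Lemma standard_borel_arrow : standard_borel R arrow.
Proof.
apply: cantor_coded_standard_borel; apply: cantor_coded_sub; last exact: measurable_arrow_set.
apply: cantor_coded_prod; first exact: cantor_coded_prod.
exact: cantor_coded_fun_space.
Qed.

Lemma measurable_asrc : measurable_fun setT asrc.
Proof.
apply: (measurableT_comp measurable_snd); apply: (measurableT_comp measurable_fst).
exact: sub_val_measurable.
Qed.

Lemma measurable_atgt : measurable_fun setT atgt.
Proof.
apply: (measurableT_comp measurable_fst); apply: (measurableT_comp measurable_fst).
exact: sub_val_measurable.
Qed.

Lemma measurable_amap : measurable_fun setT (amap : arrow -> P).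
Proof. by apply: (measurableT_comp measurable_snd); exact: sub_val_measurable. Qed.

Lemma measurable_aunit : measurable_fun setT aunit.
Proof.
apply: measurable_fun_sub; apply: measurable_fun_pair => //=.
by apply: measurable_fun_pair.
Qed.

Lemma measurable_ainv : measurable_fun setT ainv.
Proof.
apply: measurable_fun_sub; apply: measurable_fun_pair.
  by apply: measurable_fun_pair; [exact: measurable_asrc|exact: measurable_atgt].
apply: measurable_fun_fun_space => j k; rewrite setTI.
rewrite (_ : mkset _ = amap @^-1` [set g | g k = j]).
  by apply: measurable_pre; [exact: measurable_amap|exact: measurable_fun_eval].
apply/seteqP; split=> a /=; have [_ h1 h2] := fibre_group_pinv (arrow_perm a).
  by move=> <-; rewrite -[RHS]/(idfun j) -h2.
by move=> <-; rewrite -[RHS]/(idfun k) -h1.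
Qed.

Lemma measurable_amul : measurable_fun [set p : arrow * arrow | asrc p.1 = atgt p.2]
  (fun p => amul p.1 p.2).
Proof.
apply: measurable_fun_sub.
apply: (eq_measurable_fun (fun p : arrow * arrow => (atgt p.1, asrc p.2, amap p.1 \o amap p.2 : P))).
  by move=> p /set_mem /= pE; rewrite amulE.
apply: measurable_funTS; apply: measurable_fun_pair.
  apply: measurable_fun_pair.
    exact: (measurableT_comp measurable_atgt measurable_fst).
  exact: (measurableT_comp measurable_asrc measurable_snd).
apply: measurable_fun_fun_space => j k; rewrite setTI.
rewrite (_ : mkset _ = [set p : arrow * arrow | exists m : site, amap p.2 j = m /\ amap p.1 m = k]); last first.
  apply/seteqP; split=> p /=; last by move=> [m [<-]].
  by move=> h; exists (amap p.2 j).
have me (h : arrow * arrow -> arrow) i m : measurable_fun setT h ->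
    measurable [set p | amap (h p) i = m].
  move=> mh; apply: (@measurable_pre _ _ _ _ ((amap : arrow -> P) \o h) [set g : P | g i = m]).
    exact: (measurableT_comp measurable_amap mh).
  exact: measurable_fun_eval.
by apply: measurable_exists => m; apply: measurableI; apply: me;
  [exact: measurable_snd|exact: measurable_fst].
Qed.

Lemma measurable_units : measurable (units bundle).
Proof.
rewrite (_ : units _ = [set a | atgt a = asrc a] `&` amap @^-1` [set idfun : site -> site]).
  apply: measurableI.
    by apply: (measurable_eq_fun cX); [exact: measurable_atgt|exact: measurable_asrc].
  apply: measurable_pre; first exact: measurable_amap.
  exact: (measurable_point (cantor_coded_fun_space site)).
apply/seteqP; split=> [_ [x _ <-]//|a [/= ts p]].
by exists (atgt a) => //; apply: arrow_eq.
Qed.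

Lemma countable_fibre_group x : countable (fibre_group x).
Proof.
apply: (@sub_countable _ _ _ ([set (idfun : site -> site)] `|` range (fibre_word x))).
  by apply: subset_card_le => g [->|[_ [w ->]]]; [left|right; exists w].
apply: countable_setU; first exact: countable1.
by apply: countable_image; exact: countableP.
Qed.

Lemma countable_asrc x : countable (asrc @^-1` [set x]).
Proof.
have [_ cS _] := hS.
apply/countable_injP.
pose E := \bigcup_(y in [set y | rel_of S (x, y)]) ((fun g : P => (y, x, g)) @` fibre_group x).
have /countable_injP[u uinj] : countable E.
  by apply: bigcup_countable => // y _; apply: countable_image; exact: countable_fibre_group.
exists (u \o val_) => a b /set_mem /= ax /set_mem /= bx uab.
have inE' c : asrc c = x -> E (val_ c).
  move=> cx; have Sxc : rel_of S (x, atgt c) by rewrite -cx; exact: eqv_rel_sym (arrow_rel c).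
  exists (atgt c) => //; exists (amap c).
    apply: fibre_group_rel (arrow_perm c); exact: eqv_rel_sym.
  by rewrite -cx /atgt /asrc /amap; case: (val_ c) => [[]].
by apply: sub_val_inj; apply: uinj => //; rewrite inE; exact: inE'.
Qed.

Lemma atgt_ainv a : atgt (ainv a) = asrc a. Proof. by []. Qed.
Lemma asrc_ainv a : asrc (ainv a) = atgt a. Proof. by []. Qed.

Lemma ainvK : involutive ainv.
Proof.
move=> a; apply: arrow_eq => //; have [_ h1 h2] := fibre_group_pinv (arrow_perm a).
exact: pinvE h2 h1.
Qed.

Lemma countable_atgt x : countable (atgt @^-1` [set x]).
Proof.
apply: (@sub_countable _ _ _ (ainv @` (asrc @^-1` [set x]))).
  by apply: subset_card_le => a ax; exists (ainv a) => //; exact: ainvK.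
apply: countable_image; exact: countable_asrc.
Qed.

Lemma discrete_borel_bundle : discrete_borel_groupoid R bundle.
Proof.
split.
- exact: standard_borel_arrow.
- exact: measurable_units.
- split; [exact: measurable_asrc|exact: measurable_atgt|exact: measurable_aunit
    |exact: measurable_ainv|exact: measurable_amul].
- by move=> x; split; [exact: countable_asrc|exact: countable_atgt].
Qed.

(** * Nonsingularity and infinite conjugacy classes *)

(** The arrows over [X0] are the values of the countably many Borel maps sending
    [x] to [(x, f n x, fibre_word x w)].  If the targets of [A] contain a set of
    positive measure, one of these maps takes its values in [A] on a set of
    positive measure, and forgetting the permutation gives a Borel subset of the
    relation with the same sources and targets. *)
Lemma atgt_null (A : set arrow) : measurable A ->
  mu.-null_set (asrc @` A) -> mu.-null_set (atgt @` A).
Proof.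
have [mS cS nsS] := hS; have [mX0 X0c] := conullX0.
move=> /measurable_subE[C mC ->] nsA D mD DA.
pose Dn (k : nat * seq letter) :=
  [set x | (D x /\ X0 x) /\ C (x, f k.1 x, fibre_word x k.2)].
have mDn k : measurable (Dn k).
  apply: measurableI; first exact: measurableI.
  apply: (@measurable_pre _ _ _ _ (fun x => (x, f k.1 x, fibre_word x k.2)) C) => //.
  apply: measurable_fun_pair; last exact: measurable_fibre_word.
  by apply: measurable_fun_pair.
have Dn0 k : mu (Dn k) = 0%E.
  pose B := [set z : X * X | Dn k z.1 /\ z.2 = f k.1 z.1].
  have mB : measurable B.
    apply: measurableI; first exact: (@measurable_pre _ _ _ _ fst).
    by apply: (measurable_eq_fun cX); [exact: measurable_snd|exact: (measurableT_comp (mf k.1) measurable_fst)].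
  have BS : B `<=` rel_of S by move=> [x y] [_ /= ->]; exact: Sf.
  apply: ((rel_nonsingular nsS mB BS).1 _ (Dn k)) => //.
    apply: subset_null_set nsA => _ [[x y] [/= [[Dx X0x] Cx] ->] <-] /=.
    have ax : arrow_set (x, f k.1 x, fibre_word x k.2).
      by split; [exact: Sf|right; split=> //; exists k.2].
    by exists (mk_arrow ax).
  by move=> x Dx; exists (x, f k.1 x).
apply: measure_negligible => //.
apply: (@negligibleS _ _ _ _ (~` X0 `|` \bigcup_n
    (if unpickle n is Some k then Dn k else set0))).
  move=> x Dx; have [X0x|] := pselect (X0 x); last by left.
  right; have [a Ca ax] := DA x Dx.
  have [n yn] : exists n, asrc a = f n x by apply: enum => //; rewrite -ax; exact: arrow_rel.
  have [w gw] : exists w, amap a = fibre_word x w.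
    have [|[_ //]] := arrow_perm a; last by rewrite ax.
    by move=> ->; exists [::].
  exists (pickle (n, w)) => //; rewrite pickleK; split=> //.
  by rewrite /= -yn -gw -ax /atgt /asrc /amap; move: Ca => /=; case: (val_ a) => [[]].
apply: negligibleU; first by exists (~` X0); split=> //; exact: measurableC.
apply: negligible_bigcup => n; case: (unpickle n) => [k|]; last exact: negligible_set0.
by exists (Dn k); split; [exact: mDn|exact: Dn0|].
Qed.

Lemma nonsingular_bundle : nonsingular mu bundle.
Proof.
move=> A mA; rewrite mu_src_eq0P mu_tgt_eq0P; split.
  exact: atgt_null.
have mA' : measurable (ainv @^-1` A) by apply: measurable_pre => //; exact: measurable_ainv.
have st : asrc @` (ainv @^-1` A) = atgt @` A.
  apply/seteqP; split=> [_ [a Aa <-]|_ [a Aa <-]]; first by exists (ainv a).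
  by exists (ainv a) => //; rewrite /preimage /= ainvK.
have ts : atgt @` (ainv @^-1` A) = asrc @` A.
  apply/seteqP; split=> [_ [a Aa <-]|_ [a Aa <-]]; first by exists (ainv a).
  by exists (ainv a) => //; rewrite /preimage /= ainvK.
by have := atgt_null mA'; rewrite st ts.
Qed.

Lemma orbit_rel_bundle : orbit_rel bundle = rel_of S.
Proof.
apply/seteqP; split=> [_ [a _ <-]|[x y] Sxy]; first exact: arrow_rel.
have axy : arrow_set (x, y, idfun : site -> site) by split=> //; exact: fibre_group1.
by exists (mk_arrow axy).
Qed.

(** The loop at [x] given by an element of the fibre group; the unit for other
    maps. *)
Definition loop x (g : P) : arrow :=
  if pselect (arrow_set (x, x, g)) is left h then mk_arrow h else aunit x.

Lemma loopE x g : fibre_group x g -> val_ (loop x g) = (x, x, g).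
Proof.
move=> xg; rewrite /loop; case: pselect => // nxg.
by exfalso; apply: nxg; split=> //; exact: eqv_rel_refl.
Qed.

Lemma asrc_loop x g : asrc (loop x g) = x.
Proof. by rewrite /loop; case: pselect. Qed.

Lemma atgt_loop x g : atgt (loop x g) = x.
Proof. by rewrite /loop; case: pselect. Qed.

Lemma amap_loop x g : fibre_group x g -> amap (loop x g) = g.
Proof. by move=> xg; rewrite /amap loopE. Qed.

Lemma fibre_group_letter x l : X0 x -> fibre_group x (letter_map (orbit_itineraries x) l).
Proof. by move=> X0x; right; split=> //; exists [:: l]. Qed.

Lemma fibre_group_transp x j k : X0 x -> fibre_group x (transp j k).
Proof. exact: (@fibre_group_letter x (inl (inr (j, k)))). Qed.

(** If [g i = j] with [j] different from [i], conjugating [g] by the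
    transposition of [j] and [k] gives a map sending [i] to [k], for all [k] other
    than [i] and [j]; so over [X0] every loop that is not a unit has infinitely many conjugates at its base point. *)
Lemma icc_bundle : icc mu bundle.
Proof.
move=> E mE Eiso _ fin; apply: contrapT; rewrite mu_src_eq0P.
move=> /existsNP[D /not_implyP[mD /not_implyP[DE /eqP D0]]].
move: fin; rewrite /mu_src (@integral_counting_infinite _ _ _ _ _ _ _ D)// => x Dx.
have [a [Ea na] /= ax] := DE x Dx.
have ta : atgt a = x by rewrite -ax; apply/esym; exact: Eiso a Ea.
have : amap a <> (idfun : site -> site).
  by move=> ga; apply: na; exists x => //; apply: arrow_eq.
move=> ga; have X0x : X0 x by have [//|[]] := arrow_perm a; rewrite ta.
have [i gi] : exists i, amap a i <> i.
  by apply/existsNP => h; apply: ga; exact/funext.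
set j := amap a i in gi.
pose cj k := amul (amul (loop x (transp j k)) a) (ainv (loop x (transp j k))).
have l1 k : asrc (loop x (transp j k)) = atgt a by rewrite asrc_loop ta.
have l2 k : asrc (amul (loop x (transp j k)) a) = atgt (ainv (loop x (transp j k))).
  by rewrite src_amul// atgt_ainv asrc_loop.
have cjP k : k <> i -> k <> j -> amap (cj k) i = k.
  move=> /eqP ki /eqP kj; rewrite /cj amap_amul// amap_amul//.
  rewrite amap_loop; last exact: fibre_group_transp.
  have -> : amap (ainv (loop x (transp j k))) = transp j k.
    rewrite {1}/amap /= amap_loop; last exact: fibre_group_transp.
    by apply: pinvE; apply/funext => p /=; exact: transpK.
  rewrite /= (transp_id (p := i)) ?transp_l//; last by rewrite eq_sym.
  by rewrite eq_sym; exact/eqP.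
move=> fin; suff : finite_set [set: nat] by exact: infinite_nat.
have : finite_set ((fun c : arrow => amap c i) @` (conj_class bundle E `&` asrc @^-1` [set x]) `|` [set i; j]).
  by rewrite finite_setU; split; [exact: finite_image|exact: finite_set2].
move=> /(finite_image snd); apply: sub_finite_set => n _.
exists (0, n) => //=.
have [->|ni] := pselect (((0 : int), n) = i); first by right; left.
have [->|nj] := pselect (((0 : int), n) = j); first by right; right.
left; exists (cj (0, n)); last exact: cjP.
split; last by rewrite /= src_amul// asrc_ainv atgt_loop.
by exists (loop x (transp j (0, n))), a; split.
Qed.

(** * Genuineness *)

Hypothesis sepV : forall x y, (forall n, V n x <-> V n y) -> x = y.
Hypothesis diff : diffuse mu.

Lemma conull_uncountable (A B : set X) : conull mu A -> conull mu B ->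
  ~ countable (A `&` B).
Proof.
move=> cA cB cAB; have [y _] := countable_conull_atom cX (conullI cA cB) cAB.
by rewrite diff eqxx.
Qed.

Section loops_under_isomorphism.
Context (Y H : Type) (h : groupoid Y H) (X1 : set X) (phi : arrow -> H) (psi : H -> arrow).
Hypothesis psiK : forall a, reduction bundle X1 a -> psi (phi a) = a.
Hypothesis phi_comp : forall a b, reduction bundle X1 a -> reduction bundle X1 b ->
  gsrc bundle a = gtgt bundle b <-> gsrc h (phi a) = gtgt h (phi b).
Hypothesis phiM : forall a b, reduction bundle X1 a -> reduction bundle X1 b ->
  gsrc bundle a = gtgt bundle b -> phi (gmul bundle a b) = gmul h (phi a) (phi b).
Variable x : X.
Hypothesis X1x : X1 x.

Lemma loop_red g : reduction bundle X1 (loop x g).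
Proof. by split; rewrite /= ?asrc_loop ?atgt_loop. Qed.

Lemma phi_loop_comp g g' : gsrc h (phi (loop x g)) = gtgt h (phi (loop x g')).
Proof. by apply/phi_comp; [exact: loop_red|exact: loop_red|rewrite /= asrc_loop atgt_loop]. Qed.

Lemma phi_loopM (g g' : site -> site) : fibre_group x g -> fibre_group x g' ->
  phi (loop x (g \o g' : site -> site)) = gmul h (phi (loop x g)) (phi (loop x g')).
Proof.
move=> xg xg'; rewrite -phiM; [|exact: loop_red|exact: loop_red|by rewrite /= asrc_loop atgt_loop].
congr phi; apply: arrow_eq.
- by rewrite [RHS]tgt_amul ?asrc_loop ?atgt_loop.
- by rewrite [RHS]src_amul ?asrc_loop ?atgt_loop.
- rewrite [RHS]amap_amul ?asrc_loop ?atgt_loop//.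
  by rewrite !amap_loop//; exact: fibre_groupM.
Qed.

Lemma phi_loop_inj g g' : fibre_group x g -> fibre_group x g' ->
  phi (loop x g) = phi (loop x g') -> g = g'.
Proof.
move=> xg xg' /(congr1 psi); rewrite !psiK; [|exact: loop_red|exact: loop_red].
by move=> /(congr1 amap); rewrite !amap_loop.
Qed.

End loops_under_isomorphism.

(** An equivalence relation has only one loop at each point. *)
Lemma bundle_not_eqv_rel : ~ isomorphic_to_eqv_rel mu bundle.
Proof.
move=> [dY [Y [nu [S' [_ _ [X1 [Y0 [phi [psi /= [[cX1 _] [_ _ psiK _] _ [comp _ _] _]]]]]]]]]].
have [[x [X0x X1x]]|nX] := pselect (exists x, (X0 `&` X1) x); last first.
  apply: (conull_uncountable conullX0 cX1).
  rewrite (_ : _ `&` _ = set0); first exact: countable0.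
  by apply/seteqP; split=> // x X01x; apply: nX; exists x.
have pE g : phi (loop x g) = phi (loop x (idfun : site -> site)).
  have st := @phi_loop_comp _ _ (eqv_rel_groupoid S') X1 phi comp x X1x.
  have s0 := st g (idfun : site -> site); have t0 := st (idfun : site -> site) g.
  have i0 := st (idfun : site -> site) (idfun : site -> site).
  rewrite /= in s0 t0 i0; apply: val_inj.
  by rewrite [LHS]surjective_pairing [RHS]surjective_pairing s0 -t0 i0.
have := @phi_loop_inj _ X1 phi psi psiK x X1x probe (idfun : site -> site).
move=> /(_ (fibre_group_transp _ _ X0x) (fibre_group1 x) (pE _)).
by move=> /(congr1 (fun u : site -> site => u (0, 1%N))).
Qed.

(** An isomorphism induces, for each base point [x], an injective homomorphism
    [theta x] from the fibre group to the countable group [Gam].  Commutation of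
    the images is commutation in the fibre group, so by [far_toggle_commute] the
    images of the two shifts, the toggle of [x] and the probe determine the
    itinerary of [x].  Only countably many base points would exist. *)
Lemma bundle_not_transformation : ~ isomorphic_to_transformation_groupoid mu bundle.
Proof.
move=> [dY [Y [nu [Gam [act [_ cGam _ [X1 [Y0 [phi [psi /= [[cX1 _] [_ _ psiK _] _ [comp phiM _] _]]]]]]]]]]].
pose theta x (g : P) : Gam := (phi (loop x g)).2.
have thetaM x g g' : X1 x -> fibre_group x g -> fibre_group x g' ->
    theta x (g \o g' : site -> site) = (theta x g * theta x g')%g.
  by move=> X1x xg xg'; rewrite /theta (@phi_loopM _ _ (transformation_groupoid act) X1 phi phiM).
have theta_inj x g g' : X1 x -> fibre_group x g -> fibre_group x g' ->
    theta x g = theta x g' -> g = g'.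
  move=> X1x xg xg' tE; apply: (@phi_loop_inj _ X1 phi psi psiK x X1x) => //.
  apply/eqP; rewrite -pair_eqE; apply/andP; split; apply/eqP => //.
  have c := @phi_loop_comp _ _ (transformation_groupoid act) X1 phi comp x X1x.
  by have := c g g'; have := c g' g'; rewrite /= => <- ->.
have gshift x : X0 x -> fibre_group x step_right by exact: (@fibre_group_letter x (inl (inl true))).
have gunshift x : X0 x -> fibre_group x step_left by exact: (@fibre_group_letter x (inl (inl false))).
have gprobe x : X0 x -> fibre_group x probe by exact: fibre_group_transp.
have gtoggle x : X0 x -> fibre_group x (toggle (itinerary x)).
  move=> X0x; have [n xn] := enum X0x (eqv_rel_refl S x).
  by have := @fibre_group_letter x (inr n) X0x; rewrite /= /orbit_itineraries -xn.
have giter x m (g : site -> site) : fibre_group x g -> fibre_group x (iter m g).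
  move=> xg; elim: m => [|m IHm]; first exact: fibre_group1.
  by rewrite (_ : iter m.+1 g = g \o iter m g)//; exact: fibre_groupM.
have theta_iter x m (g : site -> site) : X1 x -> fibre_group x g ->
    theta x (iter m g) = (theta x g ^+ m)%g.
  move=> X1x xg; elim: m => [|m IHm].
    apply: (@mulgI _ (theta x (iter 0 g))); rewrite -thetaM ?mulg1//; exact: fibre_group1.
  rewrite (_ : iter m.+1 g = g \o iter m g)// thetaM//; last exact: giter.
  by rewrite IHm expgS.
pose key x := (theta x step_right, theta x step_left, theta x (toggle (itinerary x)), theta x probe).
pose far_key (k : Gam * Gam * Gam * Gam) m : Gam :=
  (k.1.1.2 ^+ m * (k.1.2 * k.1.1.1 ^+ m))%g.
have keyP x m : X0 x -> X1 x -> V m x <->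
    (far_key (key x) m * (key x).2 <> (key x).2 * far_key (key x) m)%g.
  move=> X0x X1x.
  have gfar : fibre_group x (far_toggle (itinerary x) m).
    apply: fibre_groupM; first exact/giter/gunshift.
    by apply: fibre_groupM; [exact: gtoggle|exact/giter/gshift].
  have -> : far_key (key x) m = theta x (far_toggle (itinerary x) m).
    rewrite /far_toggle !thetaM ?theta_iter//; try exact: gunshift; try exact: gshift.
    + exact: gtoggle.
    + exact/giter/gshift.
    + exact/giter/gunshift.
    + by apply: fibre_groupM; [exact: gtoggle|exact/giter/gshift].
  rewrite /= -!thetaM//; try exact: gprobe.
  split=> [Vmx /theta_inj h|h]; last first.
    apply: contrapT => nVmx; apply: h; congr theta.
    by apply/far_toggle_commute; apply/negP => /asboolP.
  have /far_toggle_commute/negP : far_toggle (itinerary x) m \o probe = probe \o far_toggle (itinerary x) m.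
    by apply: h => //; apply: fibre_groupM => //; exact: gprobe.
  by apply; exact/asboolP.
apply: (conull_uncountable conullX0 cX1).
have /countable_injP[u uinj] : countable [set: Gam] := cGam.
apply/countable_injP; exists (fun x => pickle (u (key x).1.1.1, u (key x).1.1.2, u (key x).1.2, u (key x).2)).
move=> x y /set_mem[X0x X1x] /set_mem[X0y X1y] /(pcan_inj pickleK)[e1 e2 e3 e4].
have kxy : key x = key y.
  by rewrite /key; congr (_, _, _, _); apply: uinj; rewrite ?inE.
by apply: sepV => m; rewrite !keyP// kxy.
Qed.

Lemma genuine_bundle : ergodic mu (rel_of S) -> genuine mu bundle.
Proof.
move=> erg; split; [by rewrite orbit_rel_bundle|exact: bundle_not_eqv_rel|exact: bundle_not_transformation].
Qed.

End bundle.

(** * Groupoids over an atom *)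

Section groupoid_cancellation.
Context (X G : Type) (g : groupoid X G).

Lemma gmulKV a b : gsrc g a = gtgt g b -> gmul g (ginv g a) (gmul g a b) = b.
Proof. by move=> ab; rewrite mul_assoc ?src_ginv// mul_inv_l ab mul_unt_l. Qed.

Lemma gmulVK a b : gtgt g a = gtgt g b -> gmul g a (gmul g (ginv g a) b) = b.
Proof. by move=> ab; rewrite mul_assoc ?tgt_ginv ?src_ginv// mul_inv_r ab mul_unt_l. Qed.

Lemma gmulrKV a b : gsrc g a = gsrc g b -> gmul g (gmul g a (ginv g b)) b = a.
Proof. by move=> ab; rewrite -mul_assoc ?tgt_ginv ?src_ginv// mul_inv_l -ab mul_unt_r. Qed.

Lemma gmulrVK a b : gsrc g a = gtgt g b -> gmul g (gmul g a b) (ginv g b) = a.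
Proof. by move=> ab; rewrite -mul_assoc ?tgt_ginv// mul_inv_r -ab mul_unt_r. Qed.

End groupoid_cancellation.

Section point_group.
Context (X : Type) (G : choiceType) (g : groupoid X G) (x0 : X) (U : zmodType).

Definition isotropy_at : set G := [set a | gsrc g a = x0 /\ gtgt g a = x0].

(** Over one countable orbit a groupoid is determined by the isotropy group at
    [x0] and the size of the orbit.  The group [U] will be in bijection with the
    orbit and act on it by translations, the isotropy group acting trivially. *)
Definition point_group : Type := (set_type isotropy_at * U)%type.

HB.instance Definition _ := Choice.on point_group.

Lemma isotropy_atP (p : point_group) : gsrc g (\val p.1) = x0 /\ gtgt g (\val p.1) = x0.
Proof. exact: set_mem (valP p.1). Qed.

Definition mk_point a (h : isotropy_at a) (u : U) : point_group :=
  (exist _ a (mem_set h) : set_type isotropy_at, u).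

Lemma point_one_subproof : isotropy_at (gunit g x0).
Proof. by split; rewrite ?src_gunit ?tgt_gunit. Qed.

Lemma point_mul_subproof (p q : point_group) : isotropy_at (gmul g (\val p.1) (\val q.1)).
Proof.
have [sp tp] := isotropy_atP p; have [sq tq] := isotropy_atP q.
by split; rewrite ?src_mul ?tgt_mul ?sp ?tq.
Qed.

Lemma point_inv_subproof (p : point_group) : isotropy_at (ginv g (\val p.1)).
Proof. by have [sp tp] := isotropy_atP p; split; rewrite ?src_ginv ?tgt_ginv. Qed.

Definition point_one := mk_point point_one_subproof 0.
Definition point_mul p q := mk_point (point_mul_subproof p q) (p.2 + q.2).
Definition point_inv p := mk_point (point_inv_subproof p) (- p.2).

Lemma point_group_eq (p q : point_group) : \val p.1 = \val q.1 -> p.2 = q.2 -> p = q.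
Proof. by case: p q => [p u] [q v] /= /val_inj -> ->. Qed.

Lemma point_mulA : associative point_mul.
Proof.
move=> p q r; apply: point_group_eq => /=; last by rewrite addrA.
have [sp tp] := isotropy_atP p; have [sq tq] := isotropy_atP q; have [sr tr] := isotropy_atP r.
by rewrite mul_assoc ?sp ?tq ?sq ?tr.
Qed.

Lemma point_mul1g : left_id point_one point_mul.
Proof.
move=> p; have [sp tp] := isotropy_atP p; apply: point_group_eq => /=; last by rewrite add0r.
by rewrite -{1}tp mul_unt_l.
Qed.

Lemma point_mulg1 : right_id point_one point_mul.
Proof.
move=> p; have [sp tp] := isotropy_atP p; apply: point_group_eq => /=; last by rewrite addr0.
by rewrite -{1}sp mul_unt_r.
Qed.

Lemma point_mulVg : left_inverse point_one point_inv point_mul.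
Proof.
move=> p; have [sp tp] := isotropy_atP p; apply: point_group_eq => /=; last by rewrite addNr.
by rewrite mul_inv_l sp.
Qed.

Lemma point_mulgV : right_inverse point_one point_inv point_mul.
Proof.
move=> p; have [sp tp] := isotropy_atP p; apply: point_group_eq => /=; last by rewrite subrr.
by rewrite mul_inv_r tp.
Qed.

HB.instance Definition _ := isGroup.Build point_group
  point_mulA point_mul1g point_mulg1 point_mulVg point_mulgV.

End point_group.

Lemma countable_card_zmod (T : Type) (C : set T) : C !=set0 -> countable C ->
  exists U : zmodType, countable [set: U] /\ (C #= [set: U])%card.
Proof.
move=> C0 cC; have [[n Cn]|infC] := pselect (finite_set C).
  case: n Cn => [|n] Cn.
    by move: C0 => /set0P; rewrite II0 card_eq0 in Cn; rewrite Cn.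
  exists 'I_n.+1; split; first exact: countableP.
  exact: card_eq_trans Cn card_II.
exists int; split; first exact: countableP.
apply: card_eq_trans (eq_card_nat cC infC) _; rewrite card_eq_sym.
apply: eq_card_nat; first exact: countableP.
move=> /(finite_image (absz)) => h; apply: infinite_nat; apply: sub_finite_set h.
by move=> n _; exists n.
Qed.

Lemma card_eq_retract (T : pointedType) (U : Type) (C : set T) (u0 : U) :
  (C #= [set: U])%card -> exists (e : T -> U) (r : U -> T),
    [/\ forall u, C (r u), cancel r e & forall y, C y -> r (e y) = y].
Proof.
rewrite card_eq_sym => /card_set_bijP[r [rC rinj rsurj]].
have eP y : exists u, C y -> r u = y.
  by have [/rsurj[u _ ru]|nCy] := pselect (C y); [exists u|exists u0].
have [e {}eP] := choice eP.
have Cr u : C (r u) by exact: rC.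
exists e, r; split=> // u; apply: rinj; rewrite ?inE//; exact: eP.
Qed.

Section atom.
Context (R : realType) d (X : measurableType d) (mu : probability X R).
Context d' (G : measurableType d') (g : groupoid X G).
Hypothesis cX : cantor_coded X.
Hypothesis mG : forall a : G, measurable [set a].
Hypothesis cg : forall x, countable (gsrc g @^-1` [set x]).
Hypothesis nsg : nonsingular mu g.
Hypothesis erg : ergodic mu (orbit_rel g).
Variable x0 : X.
Hypothesis atom : mu [set x0] != 0%E.

Definition orbit_of : set X := gtgt g @` (gsrc g @^-1` [set x0]).

Local Notation C := orbit_of.

Lemma orbit_of_self : C x0.
Proof. by exists (gunit g x0); rewrite /= ?src_gunit ?tgt_gunit. Qed.

Lemma countable_orbit : countable C.
Proof. exact/countable_image/cg. Qed.

Lemma orbit_of_tgt a : C (gsrc g a) -> C (gtgt g a).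
Proof.
move=> [b /= bx0 ba]; exists (gmul g a b); last by rewrite tgt_mul.
by rewrite /= src_mul.
Qed.

Lemma orbit_of_src a : C (gtgt g a) -> C (gsrc g a).
Proof. by have := @orbit_of_tgt (ginv g a); rewrite src_ginv tgt_ginv. Qed.

Lemma measurable_orbit : measurable C.
Proof. by apply: measurable_countable => //; exact: countable_orbit. Qed.

Lemma conull_orbit : conull mu C.
Proof.
split; first exact: measurable_orbit.
have [] := erg measurable_orbit _ => //.
  by move=> _ _ [a _ [<- <-]]; exact: orbit_of_src.
move=> C0; exfalso; move/eqP: atom; apply.
apply: (subset_measure0 _ _ _ C0); first exact: measurable_point.
  exact: measurable_orbit.
by move=> _ ->; exact: orbit_of_self.
Qed.

(** A single arrow is a Borel set, and the two fibre measures give it the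
    masses of its two ends. *)
Lemma orbit_atom y : C y -> mu [set y] != 0%E.
Proof.
move=> [a /= sa ta]; apply/eqP => y0; have := nsg (mG a); rewrite mu_src_eq0P mu_tgt_eq0P !image_set1 sa ta.
move=> [_ h]; move/eqP: atom; apply; apply: h => //; last exact: measurable_point.
by move=> D mD Dy; apply: (subset_measure0 mD (measurable_point cX y) Dy y0).
Qed.

Lemma null_off_orbit (B : set X) : measurable B ->
  mu B = 0%E <-> forall y, C y -> ~ B y.
Proof.
move=> mB; split=> [B0 y Cy By|h].
  move/eqP: (orbit_atom Cy); apply.
  by apply: (subset_measure0 (measurable_point cX y) mB _ B0) => _ ->.
have [mC C0] := conull_orbit.
by apply: (subset_measure0 mB (measurableC mC) _ C0) => y By Cy; exact: h Cy By.
Qed.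

Section transformation.
Context (U : zmodType) (cU : countable [set: U]) (e : X -> U) (r : U -> X).
Hypothesis Cr : forall u, C (r u).
Hypothesis rK : cancel r e.
Hypothesis eK : forall y, C y -> r (e y) = y.
Variable to : X -> G.
Hypothesis toP : forall y, C y -> gsrc g (to y) = x0 /\ gtgt g (to y) = y.

Local Notation Gam := (point_group g x0 U).

Definition translate (p : Gam) (y : X) : X :=
  if pselect (C y) then r (p.2 + e y) else y.

Lemma translateE p y : C y -> translate p y = r (p.2 + e y).
Proof. by rewrite /translate; case: pselect. Qed.

Lemma translate1 y : translate 1%g y = y.
Proof. by rewrite /translate; case: pselect => // Cy; rewrite add0r eK. Qed.

Lemma translateM p q y : translate (p * q)%g y = translate p (translate q y).
Proof.
rewrite {1 3}/translate; case: pselect => [Cy|nCy]; last by rewrite /translate; case: pselect.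
by rewrite translateE// rK addrA.
Qed.

Definition translation : group_action Gam X := GroupAction translate1 translateM.

Lemma nonsingular_translation : nonsingular_action mu translation.
Proof.
move=> p; have mt : measurable_fun setT (translation p).
  move=> _ B mB; rewrite setTI.
  rewrite (_ : _ @^-1` _ = (B `&` ~` C) `|` (C `&` translation p @^-1` B)).
    apply: measurableU.
      by apply: measurableI => //; apply: measurableC; exact: measurable_orbit.
    apply: measurable_countable => //; apply: sub_countable countable_orbit.
    by apply: subset_card_le => y [].
  apply/seteqP; split=> y /=; rewrite /translate.
    by case: pselect => [Cy|nCy] By; [right|left].
  by case: pselect => [Cy|nCy] [[]|[]].
split=> // B mB; rewrite !null_off_orbit//; last exact: measurable_pre.
split=> h y Cy; last by rewrite /= translateE//; apply: h; exact: Cr.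
have := h (r (- p.2 + e y)) (Cr _).
by rewrite /= translateE// rK addNKr eK.
Qed.

(** The loop at [x0] obtained by closing up [a] with the chosen arrows [to]
    from [x0]. *)
Definition arrow_class a (h : C (gsrc g a)) : G :=
  gmul g (ginv g (to (gtgt g a))) (gmul g a (to (gsrc g a))).

Lemma arrow_class_subproof a (h : C (gsrc g a)) : isotropy_at g x0 (arrow_class h).
Proof.
have [s1 t1] := toP h; have [s2 t2] := toP (orbit_of_tgt h).
by split; rewrite /arrow_class ?src_mul ?tgt_mul ?src_ginv ?tgt_ginv ?src_mul ?tgt_mul.
Qed.

Definition fwd (a : G) : X * discrete_group Gam :=
  if pselect (C (gsrc g a)) is left h then
    (gsrc g a, mk_point (arrow_class_subproof h) (e (gtgt g a) - e (gsrc g a)))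
  else (x0, 1%g : Gam).

Definition bwd (p : X * discrete_group Gam) : G :=
  gmul g (to (translate p.2 p.1)) (gmul g (\val (p.2 : Gam).1) (ginv g (to p.1))).

Lemma fwdE a : C (gsrc g a) ->
  [/\ (fwd a).1 = gsrc g a,
      \val ((fwd a).2 : Gam).1 = gmul g (ginv g (to (gtgt g a))) (gmul g a (to (gsrc g a)))
    & ((fwd a).2 : Gam).2 = e (gtgt g a) - e (gsrc g a)].
Proof. by move=> h; rewrite /fwd; case: pselect. Qed.

Lemma translate_fwd a : C (gsrc g a) -> translate (fwd a).2 (gsrc g a) = gtgt g a.
Proof.
move=> Ca; have [_ _ e2] := fwdE Ca.
by rewrite translateE// e2 subrK eK//; exact: orbit_of_tgt.
Qed.

Lemma src_bwd p : C p.1 -> gsrc g (bwd p) = p.1.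
Proof.
move=> Cp; have [s1 t1] := toP Cp; have [s2 t2] := isotropy_atP (p.2 : Gam).
have [s3 t3] : gsrc g (to (translate p.2 p.1)) = x0 /\ gtgt g (to (translate p.2 p.1)) = translate p.2 p.1.
  by apply: toP; rewrite translateE.
by rewrite /bwd !src_mul ?tgt_mul ?src_ginv ?tgt_ginv ?s1 ?s2 ?s3 ?t2.
Qed.

Lemma tgt_bwd p : C p.1 -> gtgt g (bwd p) = translate p.2 p.1.
Proof.
move=> Cp; have [s1 t1] := toP Cp; have [s2 t2] := isotropy_atP (p.2 : Gam).
have [s3 t3] : gsrc g (to (translate p.2 p.1)) = x0 /\ gtgt g (to (translate p.2 p.1)) = translate p.2 p.1.
  by apply: toP; rewrite translateE.
by rewrite /bwd !tgt_mul ?tgt_ginv ?s1 ?s2 ?s3 ?t2.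
Qed.

Lemma fwdK a : C (gsrc g a) -> bwd (fwd a) = a.
Proof.
move=> Ca; have [e1 e2 e3] := fwdE Ca.
have [s1 t1] := toP Ca; have [s2 t2] := toP (orbit_of_tgt Ca).
rewrite /bwd e2 e1 translate_fwd//.
rewrite -(mul_assoc (a := ginv g (to (gtgt g a)))) ?src_ginv ?tgt_mul ?src_mul ?tgt_ginv ?s1 ?t2 ?t1//.
rewrite gmulVK ?tgt_mul ?src_mul ?tgt_ginv ?s1 ?t1 ?t2//.
by rewrite gmulrVK.
Qed.

Lemma bwdK p : C p.1 -> fwd (bwd p) = p.
Proof.
move=> Cp; have Cs : C (gsrc g (bwd p)) by rewrite src_bwd.
have [e1 e2 e3] := fwdE Cs; rewrite src_bwd// tgt_bwd// in e1 e2 e3.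
have Cz : C (translate p.2 p.1) by rewrite translateE.
have [s1 t1] := toP Cp; have [s2 t2] := isotropy_atP (p.2 : Gam).
have [s3 t3] := toP Cz.
rewrite [LHS]surjective_pairing [RHS]surjective_pairing e1; congr pair.
apply: point_group_eq; last by rewrite e3 translateE// rK addrK.
rewrite e2 /bwd -mul_assoc ?tgt_mul ?src_mul ?tgt_ginv ?src_ginv ?s1 ?s2 ?s3 ?t1 ?t2//.
by rewrite gmulrKV ?s2 ?s1// gmulKV ?s3 ?t2.
Qed.

Lemma fwdM a b : C (gsrc g b) -> gsrc g a = gtgt g b ->
  fwd (gmul g a b) = gmul (transformation_groupoid translation) (fwd a) (fwd b).
Proof.
move=> Cb ab; have Ca : C (gsrc g a) by rewrite ab; exact: orbit_of_tgt.
have Cab : C (gsrc g (gmul g a b)) by rewrite src_mul.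
have [e1 e2 e3] := fwdE Ca; have [f1 f2 f3] := fwdE Cb; have [h1 h2 h3] := fwdE Cab.
rewrite src_mul// tgt_mul// in h1 h2 h3.
rewrite [LHS]surjective_pairing /= h1 f1; congr pair.
have [s1 t1] := toP Cb; have [s2 t2] := toP Ca; have [s3 t3] := toP (orbit_of_tgt Ca).
apply: point_group_eq => /=; last by rewrite h3 e3 f3 ab addrA subrK.
rewrite ab in s2 t2.
rewrite h2 e2 f2 -!mul_assoc ?src_mul ?tgt_mul ?tgt_ginv ?src_ginv ?s1 ?s2 ?s3 ?t1 ?t2 ?t3 ?ab//.
by rewrite gmulVK ?tgt_mul.
Qed.

Lemma fwdV a : C (gsrc g a) ->
  fwd (ginv g a) = ginv (transformation_groupoid translation) (fwd a).
Proof.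
move=> Ca; have Ct := orbit_of_tgt Ca.
have Cu : C (gsrc g (ginv g a)) by rewrite src_ginv.
have aa : gsrc g (ginv g a) = gtgt g a by rewrite src_ginv.
have [e1 e2 e3] := fwdE Ca; have [h1 _ _] := fwdE Cu.
rewrite [LHS]surjective_pairing /= h1 src_ginv e1 translate_fwd//; congr pair.
have := fwdM Ca aa; rewrite mul_inv_l.
have := fwdM (a := gunit g (gsrc g a)) (b := gunit g (gsrc g a)).
rewrite !src_gunit !tgt_gunit => /(_ Ca erefl).
rewrite -{1}(tgt_gunit g (gsrc g a)) mul_unt_l.
set q : Gam := (fwd (ginv g a)).2; set p : Gam := (fwd a).2; set u : Gam := (fwd (gunit g (gsrc g a))).2.
move=> /(congr1 snd) /= uu /(congr1 snd) /= qp.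
have u1 : u = 1%g by apply: (mulgI u); rewrite mulg1.
by apply: (mulIg p); rewrite mulVg -u1.
Qed.

Let countable_Gam : countable [set: Gam].
Proof.
have /countable_injP[u uinj] := cg x0; have /countable_injP[v vinj] := cU.
apply/countable_injP; exists (fun p => pickle (u (\val p.1), v p.2)) => p q _ _.
move=> /(pcan_inj pickleK)[e1 e2]; apply: point_group_eq; last by apply: vinj; rewrite ?inE.
have [sp _] := isotropy_atP p; have [sq _] := isotropy_atP q.
by apply: uinj; rewrite ?inE.
Qed.

Lemma isomorphic_translation : isomorphic mu g mu (transformation_groupoid translation).
Proof.
have [mC C0] := conull_orbit.
exists C, C, fwd, bwd; split.
- by split; exact: conull_orbit.
- split=> [_ [a [Ca _] <-]|_ [p [Cp _] <-]|a [Ca _]|p [Cp _]].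
  + have [e1 _ _] := fwdE Ca; split; rewrite /= e1// translate_fwd//; exact: orbit_of_tgt.
  + by split; [rewrite src_bwd|rewrite tgt_bwd// translateE].
  + exact: fwdK.
  + exact: bwdK.
- split=> mD B mB.
    apply: (countable_measurable mG).
    apply: (@sub_countable _ _ _ (\bigcup_(y in C) (gsrc g @^-1` [set y]))).
      by apply: subset_card_le => a [[Ca _] _]; exists (gsrc g a).
    by apply: bigcup_countable; [exact: countable_orbit|move=> y _; exact: cg].
  apply: countable_measurable.
    move=> [y p]; rewrite (_ : [set _] = [set y] `*` [set p]).
      by apply: measurableX => //; exact: measurable_point.
    by apply/seteqP; split=> [_ ->|[y' p'] [/= -> ->]].
  apply: (@sub_countable _ _ _ (\bigcup_(y in C) ((fun p : Gam => (y, p)) @` setT))).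
    by apply: subset_card_le => -[y p] [[Cp _] _]; exists y => //; exists p.
  apply: bigcup_countable; first exact: countable_orbit.
  by move=> y _; exact: countable_image.
- split=> [a b [Ca _] [Cb _]|a b [Ca _] [Cb _] ab|a [Ca _]].
  + have [e1 _ _] := fwdE Ca; have [f1 _ _] := fwdE Cb.
    by rewrite /= e1 f1 translate_fwd.
  + exact: fwdM.
  + exact: fwdV.
- move=> A mA AC; rewrite !mu_src_eq0P.
  suff -> : gsrc (transformation_groupoid translation) @` (fwd @` A) = gsrc g @` A by [].
  apply/seteqP; split=> [_ [_ [a Aa <-] <-]|_ [a Aa <-]]; have [Ca _] := AC a Aa; have [e1 _ _] := fwdE Ca.
    by exists a => //; rewrite -e1.
  by exists (fwd a); [exists a|].
Qed.

Hypothesis hX : standard_borel R X.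

Lemma transformation_of_atom : isomorphic_to_transformation_groupoid mu g.
Proof.
exists d, X, mu, Gam, translation; split=> //.
- exact: nonsingular_translation.
- exact: isomorphic_translation.
Qed.

End transformation.
End atom.

(** Over an atom the groupoid lives on one countable orbit, hence it is a
    transformation groupoid. *)
Lemma genuine_diffuse (R : realType) d (X : measurableType d) (mu : probability X R)
    d' (G : measurableType d') (g : groupoid X G) :
  standard_borel R X -> discrete_measured_groupoid mu g -> genuine mu g -> diffuse mu.
Proof.
move=> hX hg [erg _ nt] x0; apply: contrapT => /eqP atom; apply: nt.
have cX := standard_borel_cantor_coded hX; have [[sG _ _ cg] nsg] := hg.
have mG := measurable_point (standard_borel_cantor_coded sG).
have csrc x : countable (gsrc g @^-1` [set x]) by have [] := cg x.
have [U [cU CU]] := countable_card_zmod (ex_intro _ _ (orbit_of_self g x0)) (countable_orbit csrc x0).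
have [e [r [Cr rK eK]]] := card_eq_retract (0 : U) CU.
have toP y : exists a, orbit_of g x0 y -> gsrc g a = x0 /\ gtgt g a = y.
  have [[a sa ta]|nC] := pselect (orbit_of g x0 y); first by exists a.
  by exists (gunit g x0).
have [to {}toP] := choice toP.
by have := transformation_of_atom cX mG csrc nsg erg atom cU Cr rK eK toP hX.
Qed.

(** * The equivalence *)

Lemma diffuse_genuine_icc (R : realType) d (X : measurableType d)
    (mu : probability X R) (S : eqv_rel X) :
  standard_borel R X -> countable_measured_eqv_rel mu S -> ergodic mu (rel_of S) ->
  diffuse mu ->
  exists (d' : measure_display) (G : measurableType d') (g : groupoid X G),
    [/\ discrete_measured_groupoid mu g, genuine mu g, icc mu g
      & associated_eqv_rel mu g S].
Proof.
move=> hX hS hE hd; have cX := standard_borel_cantor_coded hX.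
have [f [X0 [mf Sf cX0 enum X0_inv]]] := orbit_enum cX hS.
have [I [c [ic mc _ _]]] := cX.
pose V n := [set x | if unpickle n is Some i then c x i else false].
have mV n : measurable (V n).
  rewrite /V; case: (unpickle n) => [i|]; last exact: measurable_const.
  exact: (@measurable_pre _ _ _ _ c [set b | b i] mc (measurable_cylinder i)).
have sepV x y : (forall n, V n x <-> V n y) -> x = y.
  move=> h; apply: ic; apply/funext => i; have := h (pickle i).
  by rewrite /V /= pickleK => -[h1 h2]; apply/idP/idP.
exists _, _, (bundle V Sf enum X0_inv); split.
- split; first exact: (discrete_borel_bundle cX hS mf Sf cX0 enum X0_inv mV).
  exact: (nonsingular_bundle cX hS mf Sf cX0 enum X0_inv mV).
- exact: genuine_bundle.
- exact: icc_bundle.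
- exists setT; first by split; [exact: measurableT|rewrite setCT measure0].
  by move=> x y _ _; rewrite orbit_rel_bundle.
Qed.

Lemma measurable_eqv_rel_point (R : realType) d (X : measurableType d) (S : eqv_rel X)
    (p : eqv_rel_space S) : cantor_coded X -> measurable [set p].
Proof.
move=> cX; exists [set \val p]; first exact: measurable_point (cantor_coded_prod cX cX) _.
by rewrite setTI; apply/seteqP; split=> [q /= /val_inj//|_ ->].
Qed.

Lemma measurable_fun_eqv_rel d d' (T : measurableType d) (X : measurableType d')
    (S : eqv_rel X) (f : T -> eqv_rel_space S) :
  measurable_fun setT (fun t => \val (f t) : X * X) -> measurable_fun setT f.
Proof.
move=> mf _ B [D mD <-]; rewrite !setTI; exact: (measurable_pre mf mD).
Qed.

Lemma measurable_eqv_rel_val d (X : measurableType d) (S : eqv_rel X) :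
  measurable_fun setT (fun p : eqv_rel_space S => \val p : X * X).
Proof. by move=> _ B mB; rewrite setTI; exists B => //; rewrite setTI. Qed.

(** A conull set of units of a countable relation contains a point of positive
    mass; the inverse isomorphism sends its unit to an arrow whose source is an
    atom. *)
Lemma diffuse_not_type_I (R : realType) d (X : measurableType d)
    (mu : probability X R) (S : eqv_rel X) :
  standard_borel R X -> diffuse mu -> ~ type_I mu S.
Proof.
move=> hX hd [n [d' [Y [nu [sY cardY _ [X0 [Y0 [phi [psi [[cX0 cY0] [_ psiY _ psiK] _ _ null]]]]]]]]]].
have cX := standard_borel_cantor_coded hX; have cY := standard_borel_cantor_coded sY.
have cT : countable [set: Y].
  move: cardY; case: (n) => [k|] cardY; last by rewrite (eq_countable cardY); exact: countableP.
  by apply: finite_set_countable; apply/finite_setP; exists k.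
have [y0 Yy0 ny0] := countable_conull_atom cY cY0 (sub_countable (subset_card_le (@subsetT _ Y0)) cT).
pose b := gunit (eqv_rel_groupoid (full_eqv_rel Y)) y0.
have Hb : reduction (eqv_rel_groupoid (full_eqv_rel Y)) Y0 b by [].
have Ga : reduction (eqv_rel_groupoid S) X0 (psi b) by apply: psiY; exists b.
have := null [set psi b] (measurable_eqv_rel_point R _ cX) (ltac:(by move=> _ ->)).
rewrite !mu_src_eq0P !image_set1 psiK// => -[h _].
move/eqP: ny0; apply; apply: h => //; last exact: measurable_point.
move=> D mD Dx; apply: subset_measure0 mD _ Dx (hd _); exact: measurable_point.
Qed.

Section atom_type_I.
Context (R : realType) d (X : measurableType d) (mu : probability X R) (S : eqv_rel X).
Hypothesis hX : standard_borel R X.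
Hypothesis hS : countable_measured_eqv_rel mu S.
Hypothesis erg : ergodic mu (rel_of S).
Variable x0 : X.
Hypothesis atom : mu [set x0] != 0%E.

Let cX : cantor_coded X := standard_borel_cantor_coded hX.

Local Notation gS := (eqv_rel_groupoid S).
Local Notation C := (orbit_of gS x0).

Let countable_src x : countable (gsrc gS @^-1` [set x]).
Proof.
have [_ cS _] := hS.
have /countable_injP[u uinj] := cS x; apply/countable_injP.
exists (fun p : eqv_rel_space S => u (\val p).1) => p q /set_mem /= px /set_mem /= qx upq.
have rel (p' : eqv_rel_space S) : (\val p').2 = x -> rel_of S (x, (\val p').1).
  by move=> <-; apply: eqv_rel_sym; rewrite -surjective_pairing; exact: set_mem (valP p').
apply: val_inj; rewrite [LHS]surjective_pairing [RHS]surjective_pairing px qx; congr pair.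
by apply: uinj => //; rewrite inE; exact: rel.
Qed.

Let nsS : nonsingular mu gS. Proof. by have [_ _ ?] := hS. Qed.

Let orbit_rel_gS : orbit_rel gS = rel_of S.
Proof.
apply/seteqP; split=> [_ [p _ <-]|[x y] Sxy].
  by rewrite /= -surjective_pairing; exact: set_mem (valP p).
by exists (exist _ (x, y) (mem_set Sxy)).
Qed.

Let mS (p : eqv_rel_space S) : measurable [set p]. Proof. exact: measurable_eqv_rel_point. Qed.

Let ergS : ergodic mu (orbit_rel gS). Proof. by rewrite orbit_rel_gS. Qed.

Let Cconull := conull_orbit cX countable_src ergS atom.
Let Catom := orbit_atom cX mS nsS atom.
Let Ccountable : countable C := countable_orbit countable_src x0.

Let C_rel x y : C x -> C y -> rel_of S (x, y).
Proof.
move=> [p /= px0 <-] [q /= qx0 <-].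
apply: (@eqv_rel_trans _ S _ x0).
  by rewrite -px0 -surjective_pairing; exact: set_mem (valP p).
by apply: eqv_rel_sym; rewrite -qx0 -surjective_pairing; exact: set_mem (valP q).
Qed.

(** Any countable model [Y] of the orbit of the atom, all of whose points have
    positive mass, exhibits the type of the relation. *)
Section complete_relation.
Context d' (Y : measurableType d') (nu : probability Y R) (q : X -> Y) (v : Y -> X).
Hypothesis mY : forall y : Y, measurable [set y].
Hypothesis mq : measurable_fun setT q.
Hypothesis mv : measurable_fun setT v.
Hypothesis vC : forall y, C (v y).
Hypothesis qK : forall x, C x -> v (q x) = x.
Hypothesis vK : cancel v q.
Hypothesis nu_atom : forall y, nu [set y] != 0%E.

Local Notation gY := (eqv_rel_groupoid (full_eqv_rel Y)).

Let null_nu (T : Type) (h : T -> Y) (A : set T) : nu.-null_set (h @` A) <-> A = set0.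
Proof.
split=> [nA|->]; last by move=> D mD; rewrite image_set0 subset0 => ->.
apply/seteqP; split=> // a Aa; move/eqP: (nu_atom (h a)); apply; apply: nA => //.
by move=> _ ->; exists a.
Qed.

Let null_mu (T : Type) (h : T -> X) (A : set T) : (forall a, A a -> C (h a)) ->
  mu.-null_set (h @` A) <-> A = set0.
Proof.
move=> AC; split=> [nA|->]; last by move=> D mD; rewrite image_set0 subset0 => ->.
apply/seteqP; split=> // a Aa; move/eqP: (Catom (AC a Aa)); apply; apply: nA.
  exact: measurable_point.
by move=> _ ->; exists a.
Qed.

Lemma countable_measured_full : countable_measured_eqv_rel nu (full_eqv_rel Y).
Proof.
split; first exact: measurableT.
- move=> y; apply: (@sub_countable _ _ _ (q @` C)); last exact: countable_image.
  by apply: subset_card_le => z _; exists (v z).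
- move=> A mA; apply: iff_trans (mu_src_eq0P nu gY A) _.
  apply: iff_trans _ (iff_sym (mu_tgt_eq0P nu gY A)).
  exact: iff_trans (null_nu _ _) (iff_sym (null_nu _ _)).
Qed.

Definition to_model (p : eqv_rel_space S) : eqv_rel_space (full_eqv_rel Y) :=
  exist _ (q (\val p).1, q (\val p).2) (mem_set I).

Lemma of_model_subproof (b : eqv_rel_space (full_eqv_rel Y)) :
  rel_of S (v (\val b).1, v (\val b).2).
Proof. by apply: C_rel; exact: vC. Qed.

Definition of_model (b : eqv_rel_space (full_eqv_rel Y)) : eqv_rel_space S :=
  exist _ (v (\val b).1, v (\val b).2) (mem_set (of_model_subproof b)).

Lemma isomorphic_full : isomorphic mu gS nu gY.
Proof.
have qinj x y : C x -> C y -> q x = q y -> x = y.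
  by move=> Cx Cy /(congr1 v); rewrite !qK.
exists C, setT, to_model, of_model; split.
- by split=> //; split; [exact: measurableT|rewrite setCT measure0].
- split.
  + by [].
  + by move=> _ [b _ <-]; split; exact: vC.
  + move=> p [/= sp tp]; apply: val_inj; rewrite /= !qK//; exact/esym/surjective_pairing.
  + by move=> b _; apply: val_inj; rewrite /= !vK; exact/esym/surjective_pairing.
- split; apply: measurable_funTS; apply: measurable_fun_eqv_rel; apply: measurable_fun_pair.
  + exact: (measurableT_comp mq (measurableT_comp measurable_fst (@measurable_eqv_rel_val _ _ S))).
  + exact: (measurableT_comp mq (measurableT_comp measurable_snd (@measurable_eqv_rel_val _ _ S))).
  + exact: (measurableT_comp mv (measurableT_comp measurable_fst (@measurable_eqv_rel_val _ _ _))).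
  + exact: (measurableT_comp mv (measurableT_comp measurable_snd (@measurable_eqv_rel_val _ _ _))).
- split=> [a b [sa ta] [sb tb]|a b [sa ta] [sb tb] ab|a _].
  + split=> [/= ->//|]; exact: qinj.
  + rewrite /= in ab; apply: val_inj => /=; case: pselect => // ab'.
    by case: pselect => //= -[]; rewrite ab.
  + by apply: val_inj.
- move=> A mA AC; apply: iff_trans (mu_src_eq0P mu gS A) _.
  apply: iff_trans _ (iff_sym (mu_src_eq0P nu gY _)).
  apply: iff_trans (null_mu _) _; first by move=> p /AC[].
  apply: iff_trans _ (iff_sym (null_nu _ _)).
  split=> [->|fA]; first by rewrite image_set0.
  by apply/seteqP; split=> // p Ap; have : (to_model @` A) (to_model p); [exists p|rewrite fA].
Qed.

Lemma type_I_of_model : standard_borel R Y -> ([set: Y] #= C)%card -> type_I mu S.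
Proof.
move=> sY YC; have [[n Cn]|infC] := pselect (finite_set C).
  exists (Some n), d', Y, nu; split=> //.
  - exact: card_eq_trans YC Cn.
  - exact: countable_measured_full.
  - exact: isomorphic_full.
exists None, d', Y, nu; split=> //.
- exact: card_eq_trans YC (eq_card_nat Ccountable infC).
- exact: countable_measured_full.
- exact: isomorphic_full.
Qed.

End complete_relation.

Let C0 : C !=set0. Proof. by exists x0; exact: orbit_of_self. Qed.

Local Notation Y := (sub_space C0).
Local Notation v := (@sub_val _ _ _ C0).

Definition retract (x : X) : Y :=
  if pselect (C x) is left h then to_sub C0 h else to_sub C0 (orbit_of_self gS x0).

Let retractK x : C x -> v (retract x) = x.
Proof. by rewrite /retract; case: pselect. Qed.

Let valK y : retract (v y) = y.
Proof. by apply: sub_val_inj; rewrite retractK//; exact: sub_valP. Qed.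

Let measurable_retract : measurable_fun setT retract.
Proof.
move=> _ B mB; rewrite setTI.
rewrite (_ : _ @^-1` _ = (C `&` retract @^-1` B) `|`
    (~` C `&` [set _ | B (to_sub C0 (orbit_of_self gS x0))])).
  apply: measurableU.
    apply: measurable_countable => //; apply: sub_countable Ccountable.
    by apply: subset_card_le => x [].
  by apply: measurableI; [apply: measurableC; have [] := Cconull|exact: measurable_const].
have qN x : ~ C x -> retract x = to_sub C0 (orbit_of_self gS x0).
  by rewrite /retract; case: pselect.
apply/seteqP; split=> x /=.
  by have [Cx|nCx] := pselect (C x); [left|right; split=> //; rewrite -(qN x nCx)].
by move=> [[]//|[nCx Bx]]; rewrite (qN x nCx).
Qed.

HB.instance Definition _ := isMeasurableFun.Build _ _ _ _ retract measurable_retract.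

Let cY : cantor_coded Y.
Proof. by apply: cantor_coded_sub => //; have [] := Cconull. Qed.

Let retract_atom (y : Y) : distribution mu retract [set y] != 0%E.
Proof.
have Cy := sub_valP y; apply: contra (Catom Cy) => /eqP y0; apply/eqP.
apply: (@subset_measure0 _ _ _ mu [set v y] (retract @^-1` [set y])) => //.
- exact: measurable_point.
- by apply: measurable_pre => //; exact: measurable_point.
- by move=> _ -> /=; exact: valK.
Qed.

Lemma type_I_of_atom : type_I mu S.
Proof.
apply: (@type_I_of_model _ Y (distribution mu retract) retract v) => //.
- exact: measurable_point.
- exact: sub_val_measurable.
- exact: sub_valP.
- exact: cantor_coded_standard_borel.
- exact: card_setT.
Qed.

End atom_type_I.

Theorem theorem4p2 (R : realType) (d : measure_display) (X : measurableType d)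
    (mu : probability X R) (S : eqv_rel X)
    (hX : standard_borel R X)
    (hS : countable_measured_eqv_rel mu S)
    (hE : ergodic mu (rel_of S)) :
  [<-> diffuse mu;
       ~ type_I mu S;
       exists (d' : measure_display) (G : measurableType d') (g : groupoid X G),
         [/\ discrete_measured_groupoid mu g, genuine mu g
           & associated_eqv_rel mu g S];
       exists (d' : measure_display) (G : measurableType d') (g : groupoid X G),
         [/\ discrete_measured_groupoid mu g, genuine mu g, icc mu g
           & associated_eqv_rel mu g S]].
Proof.
have not_type_I_diffuse : ~ type_I mu S -> diffuse mu.
  move=> nI x0; apply: contrapT => /eqP atom; apply: nI.
  by have := type_I_of_atom hX hS hE atom.
tfae.
- exact: diffuse_not_type_I.
- move=> /not_type_I_diffuse /(diffuse_genuine_icc hX hS hE)[d' [G [g [hg gen _ assoc]]]].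
  by exists d', G, g.
- move=> [d' [G [g [hg gen _]]]]; apply: diffuse_genuine_icc => //.
  exact: genuine_diffuse hg gen.
- by move=> [d' [G [g [hg gen _ _]]]]; exact: genuine_diffuse hg gen.
Qed.
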